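(* The natural morphism $Q_2 \to Q_3$ is injective, and, identifying $Q_2$ with the subalgebra of $Q_3$ generated by $s_1$: (1) $Q_3$ is a free $R$-module of rank $20$; (2) $Q_3 = Q_2 + Q_2 s_2 Q_2 + Q_2 s_2^{-1} Q_2 + R\, s_2 s_1^{-1} s_2$; (3) $Q_3 = Q_2 + Q_2 s_2 Q_2 + Q_2 s_2^{-1} Q_2 + R\, s_2^{-1} s_1 s_2^{-1}$.
   Context: $R=\mathbb{Z}[a^{\pm1},b^{\pm1},c^{\pm1}]$. $B_n$ is the braid group on $n$ strands with Artin generators $s_1,\dots,s_{n-1}$. For $n\ge 2$, $Q_n$ is the quotient of the group algebra $RB_n$ by the two-sided ideal generated by the cubic relation $(s_1-a)(s_1-b)(s_1-c)=0$ and, when $n\geq 3$, the relation $$s_1^{-1}s_2s_1 = s_1 s_2 s_1^{-1} - a^{-1} s_1 s_2 + a s_1 s_2^{-1} + a s_1^{-1}s_2 - a^3 s_1^{-1} s_2^{-1}+ a^{-1} s_2 s_1 - a s_2 s_1^{-1} - a s_2^{-1} s_1 + a^3 s_2^{-1}s_1^{-1} + a^2 s_1^{-1} s_2^{-1} s_1- a^2 s_1 s_2^{-1} s_1^{-1}.$$ Thus $Q_2=R[s_1^{\pm 1}]/((s_1-a)(s_1-b)(s_1-c))$. For subsets, $XyZ$ denotes the $R$-span of products $xyz$, $x\in X$, $z\in Z$. *)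

(* Defs.v *)
From HB Require Import structures.
From mathcomp Require Import all_boot all_order all_algebra.
From mathcomp Require Import finmap.
From mathcomp Require Import boolp classical_sets.
From mathcomp Require Import monalg.
From mathcomp Require Import ring.

Set Implicit Arguments.
Unset Strict Implicit.
Unset Printing Implicit Defensive.

Import GRing.Theory.
Local Open Scope quotient_scope.
Local Open Scope ring_scope.

(** A word is a list of letters [(x, e)], standing for the generator [x] when
   [e = true] and for its formal inverse when [e = false]. *)

Notation word X := (seq (X * bool)).

Section Presentation.
Variables (X : choiceType) (rel : word X -> word X -> Prop).

Inductive pres_eq : word X -> word X -> Prop :=
| PresRel u v : rel u v -> pres_eq u v
| PresCancel x e : pres_eq [:: (x, e); (x, ~~ e)] [::]
| PresCat u u' v v' : pres_eq u u' -> pres_eq v v' ->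
    pres_eq (u ++ v) (u' ++ v')
| PresRefl u : pres_eq u u
| PresSym u v : pres_eq u v -> pres_eq v u
| PresTrans u v w : pres_eq u v -> pres_eq v w -> pres_eq u w.

Definition pres_eqb (u v : word X) : bool := `[< pres_eq u v >].

Lemma pres_eqb_refl : reflexive pres_eqb.
Proof. by move=> u; apply/asboolP/PresRefl. Qed.

Lemma pres_eqb_sym : symmetric pres_eqb.
Proof. by move=> u v; apply/asboolP/asboolP; apply: PresSym. Qed.

Lemma pres_eqb_trans : transitive pres_eqb.
Proof.
by move=> v u w /asboolP uv /asboolP vw; apply/asboolP/(PresTrans uv vw).
Qed.

Canonical pres_equiv := EquivRel pres_eqb
  pres_eqb_refl pres_eqb_sym pres_eqb_trans.

Definition pres_group : Type := {eq_quot pres_equiv}.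

HB.instance Definition _ := Choice.on pres_group.
HB.instance Definition _ := EqQuotient.on pres_group.

End Presentation.

HB.lock Definition pres_class (X : choiceType)
    (rel : word X -> word X -> Prop) (u : word X) : pres_group rel :=
  \pi_(pres_group rel) u.
Canonical pres_class_unlockable := Unlockable pres_class.unlock.

Arguments PresRel {X rel u v}.
Arguments PresCancel {X rel} x e.
Arguments PresCat {X rel u u' v v'}.
Arguments PresRefl {X rel u}.
Arguments PresSym {X rel u v}.
Arguments PresTrans {X rel u v w}.

Section PresentedGroup.
Variables (X : choiceType) (rel : word X -> word X -> Prop).
Local Notation pres_eq := (@pres_eq X rel).
Local Notation pres_group := (@pres_group X rel).
Local Notation pres_class := (@pres_class X rel).

Lemma pres_classP u v : pres_eq u v <-> pres_class u = pres_class v.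
Proof.
rewrite unlock; split=> [uv|/eqP].
  by apply/eqP; rewrite piE; apply/asboolP.
by rewrite piE => /asboolP.
Qed.

Lemma pres_classK (x : pres_group) : pres_class (repr x) = x.
Proof. by rewrite unlock reprK. Qed.

Definition word_inv (u : word X) : word X := rev [seq (l.1, ~~ l.2) | l <- u].

Lemma word_inv_cat u v : word_inv (u ++ v) = word_inv v ++ word_inv u.
Proof. by rewrite /word_inv map_cat rev_cat. Qed.

Lemma word_invK : involutive word_inv.
Proof.
move=> u; rewrite /word_inv map_rev revK -map_comp.
by rewrite -[RHS]map_id; apply: eq_map => -[x e] /=; rewrite negbK.
Qed.

Lemma pres_eq_mulwV u : pres_eq (u ++ word_inv u) [::].
Proof.
elim: u => [|[x e] u IHu]; first exact: PresRefl.
rewrite -cat1s word_inv_cat -catA (catA u).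
apply: PresTrans (PresCancel x e); rewrite -[X in pres_eq _ X]cat1s.
apply: PresCat; first exact: PresRefl.
by rewrite -[X in pres_eq _ X]cat0s; apply: PresCat => //; apply: PresRefl.
Qed.

Lemma pres_eq_mulVw u : pres_eq (word_inv u ++ u) [::].
Proof. by rewrite -[X in _ ++ X]word_invK; apply: pres_eq_mulwV. Qed.

Lemma pres_eq_inv u v : pres_eq u v -> pres_eq (word_inv u) (word_inv v).
Proof.
move=> uv; apply: (PresTrans (v := word_inv u ++ (v ++ word_inv v))).
  rewrite -[X in pres_eq X _]cats0; apply: PresCat; first exact: PresRefl.
  exact/PresSym/pres_eq_mulwV.
rewrite catA -[X in pres_eq _ X]cat0s; apply: PresCat; last exact: PresRefl.
apply: PresTrans (pres_eq_mulVw u).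
by apply: PresCat; [apply: PresRefl | apply: PresSym].
Qed.

Definition pres_mul (x y : pres_group) := pres_class (repr x ++ repr y).
Definition pres_inv (x : pres_group) := pres_class (word_inv (repr x)).

Lemma pres_mulE u v :
  pres_mul (pres_class u) (pres_class v) = pres_class (u ++ v).
Proof.
by apply/pres_classP; apply: PresCat; apply/pres_classP; apply: pres_classK.
Qed.

Lemma pres_invE u : pres_inv (pres_class u) = pres_class (word_inv u).
Proof.
by apply/pres_classP; apply: pres_eq_inv; apply/pres_classP/pres_classK.
Qed.

Lemma pres_mulA : associative pres_mul.
Proof.
move=> x y z; rewrite -[x]pres_classK -[y]pres_classK -[z]pres_classK.
by rewrite !pres_mulE catA.
Qed.

Lemma pres_mul1g : left_id (pres_class [::]) pres_mul.
Proof. by move=> x; rewrite -[x]pres_classK pres_mulE. Qed.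

Lemma pres_mulg1 : right_id (pres_class [::]) pres_mul.
Proof. by move=> x; rewrite -[x]pres_classK pres_mulE cats0. Qed.

Lemma pres_mulVg : left_inverse (pres_class [::]) pres_inv pres_mul.
Proof.
move=> x; rewrite -[x]pres_classK pres_invE pres_mulE.
exact/pres_classP/pres_eq_mulVw.
Qed.

Lemma pres_mulgV : right_inverse (pres_class [::]) pres_inv pres_mul.
Proof.
move=> x; rewrite -[x]pres_classK pres_invE pres_mulE.
exact/pres_classP/pres_eq_mulwV.
Qed.

HB.instance Definition _ := isGroup.Build pres_group
  pres_mulA pres_mul1g pres_mulg1 pres_mulVg pres_mulgV.

Definition pres_gen (x : X) : pres_group := pres_class [:: (x, true)].

Lemma pres_classM u v :
  pres_class (u ++ v) = (pres_class u * pres_class v)%g.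
Proof. by rewrite -pres_mulE. Qed.

Lemma pres_class1 : pres_class [::] = 1%g.
Proof. by []. Qed.

Lemma pres_genV x : (pres_gen x)^-1%g = pres_class [:: (x, false)].
Proof. exact: pres_invE. Qed.

Section Lift.
Variables (M : Type) (e : M) (op : Monoid.law e) (f : X * bool -> M).
Hypothesis f_rel : forall u v, rel u v ->
  \big[op/e]_(l <- u) f l = \big[op/e]_(l <- v) f l.
Hypothesis f_inv : forall x b, op (f (x, b)) (f (x, ~~ b)) = e.

Definition pres_lift (x : pres_group) : M := \big[op/e]_(l <- repr x) f l.

Lemma pres_lift_eq u v : pres_eq u v ->
  \big[op/e]_(l <- u) f l = \big[op/e]_(l <- v) f l.
Proof.
elim=> {u v} // [x b|u u' v v' _ IHu _ IHv|u v w _ -> _ ->] //.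
  by rewrite !big_cons big_nil Monoid.mulm1.
by rewrite !big_cat /= IHu IHv.
Qed.

Lemma pres_lift_class u : pres_lift (pres_class u) = \big[op/e]_(l <- u) f l.
Proof. exact/pres_lift_eq/pres_classP/pres_classK. Qed.

Lemma pres_lift1 : pres_lift 1%g = e.
Proof. by rewrite -pres_class1 pres_lift_class big_nil. Qed.

Lemma pres_liftM x y : pres_lift (x * y)%g = op (pres_lift x) (pres_lift y).
Proof.
rewrite -[x]pres_classK -[y]pres_classK -pres_classM !pres_lift_class.
by rewrite big_cat.
Qed.

Lemma pres_lift_gen x : pres_lift (pres_gen x) = f (x, true).
Proof. by rewrite pres_lift_class big_seq1. Qed.

Lemma pres_lift_genV x : pres_lift (pres_gen x)^-1%g = f (x, false).
Proof. by rewrite pres_genV pres_lift_class big_seq1. Qed.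

End Lift.

End PresentedGroup.

(** The underlying module is the library's free module [{malg K[G]}]; the
   library only equips it with a product when [G] is a monoid without
   non-trivial units, so the convolution product is defined here.  The operations are locked:
   with transparent ones, comparing two distinct elements of a group algebra
   over [laurent] below makes conversion diverge. *)

Definition grpalg (K : nzRingType) (G : groupType) : Type := {malg K[G]}.

HB.instance Definition _ (K : nzRingType) (G : groupType) :=
  Choice.on (grpalg K G).

HB.lock Definition grpmono (K : nzRingType) (G : groupType)
    (c : K) (g : G) : grpalg K G := << c *g g >>.

HB.lock Definition grpadd (K : nzRingType) (G : groupType)
    (x y : grpalg K G) : grpalg K G :=
  (x : {malg K[G]}) + (y : {malg K[G]}).

HB.lock Definition grpopp (K : nzRingType) (G : groupType)
    (x : grpalg K G) : grpalg K G := - (x : {malg K[G]}).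

HB.lock Definition grpscale (K : nzRingType) (G : groupType)
    (c : K) (x : grpalg K G) : grpalg K G := c *: (x : {malg K[G]}).

Section GroupAlgebraModule.
Variables (K : nzRingType) (G : groupType).
Implicit Types (x y z : grpalg K G) (g h : G).
Local Notation grpadd := (@grpadd K G).
Local Notation grpopp := (@grpopp K G).
Local Notation grpscale := (@grpscale K G).

Lemma grpaddA : associative grpadd.
Proof. by move=> x y z; rewrite grpadd.unlock addrA. Qed.

Lemma grpaddC : commutative grpadd.
Proof. by move=> x y; rewrite grpadd.unlock addrC. Qed.

Lemma grpadd0x : left_id (0 : {malg K[G]}) grpadd.
Proof. by move=> x; rewrite grpadd.unlock add0r. Qed.

Lemma grpaddNx : left_inverse (0 : {malg K[G]}) grpopp grpadd.
Proof. by move=> x; rewrite grpadd.unlock grpopp.unlock addNr. Qed.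

HB.instance Definition _ := GRing.isZmodule.Build (grpalg K G)
  grpaddA grpaddC grpadd0x grpaddNx.

Lemma grpcoeff0 g : (0 : grpalg K G)@_g = 0.
Proof. exact: mcoeff0. Qed.

Lemma grpcoeffD x y g : (x + y)@_g = x@_g + y@_g.
Proof. by rewrite -[x + y]/(grpadd x y) grpadd.unlock mcoeffD. Qed.

Lemma grpscaleA c d x : grpscale c (grpscale d x) = grpscale (c * d) x.
Proof. by rewrite grpscale.unlock scalerA. Qed.

Lemma grpscale1 : left_id 1 grpscale.
Proof. by move=> x; rewrite grpscale.unlock scale1r. Qed.

Lemma grpscaleDr : right_distributive grpscale +%R.
Proof.
move=> c x y; rewrite -[x + y]/(grpadd x y) -[RHS]/(grpadd _ _).
by rewrite grpscale.unlock grpadd.unlock scalerDr.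
Qed.

Lemma grpscaleDl x : {morph grpscale^~ x : c d / c + d}.
Proof.
move=> c d; rewrite -[RHS]/(grpadd _ _).
by rewrite grpscale.unlock grpadd.unlock scalerDl.
Qed.

HB.instance Definition _ := GRing.Zmodule_isLmodule.Build K (grpalg K G)
  grpscaleA grpscale1 grpscaleDr grpscaleDl.

Lemma grpcoeffZ (c : K) x g : (c *: x)@_g = c * x@_g.
Proof. by rewrite -[c *: x]/(grpscale c x) grpscale.unlock mcoeffZ. Qed.

Lemma grpsuppD x y : (msupp (x + y) `<=` msupp x `|` msupp y)%fset.
Proof. by rewrite -[x + y]/(grpadd x y) grpadd.unlock msuppD_le. Qed.

Lemma grpsuppZ (c : K) x : (msupp (c *: x) `<=` msupp x)%fset.
Proof. by rewrite -[c *: x]/(grpscale c x) grpscale.unlock msuppZ_le. Qed.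

Lemma grpmono0 g : grpmono 0 g = 0 :> grpalg K G.
Proof. by rewrite grpmono.unlock monalgU0. Qed.

Lemma grpmonoD (c d : K) g : grpmono (c + d) g = grpmono c g + grpmono d g.
Proof.
by rewrite -[RHS]/(grpadd _ _) grpadd.unlock grpmono.unlock monalgUD.
Qed.

Lemma grpcoeffU (c : K) g h : (grpmono c g)@_h = c *+ (g == h).
Proof. by rewrite grpmono.unlock mcoeffU. Qed.

Lemma grpcoeffUU (c : K) g : (grpmono c g)@_g = c.
Proof. by rewrite grpcoeffU eqxx. Qed.

Lemma grpsuppU (c : K) g : (msupp (grpmono c g) `<=` [fset g])%fset.
Proof. by rewrite grpmono.unlock msuppU_le. Qed.

Lemma grpalgE x : x = \sum_(g <- msupp x) grpmono (x@_g) g.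
Proof.
rewrite {1}[x]monalgE grpmono.unlock.
apply: (big_morph (fun z : {malg K[G]} => z : grpalg K G)) => // u v.
by rewrite -[RHS]/(grpadd _ _) grpadd.unlock.
Qed.

End GroupAlgebraModule.

Definition grpU (K : nzRingType) (G : groupType) (g : G) : grpalg K G :=
  grpmono 1 g.

HB.lock Definition grpmul (K : nzRingType) (G : groupType)
    (x y : grpalg K G) : grpalg K G :=
  \sum_(g <- msupp x) \sum_(h <- msupp y) grpmono (x@_g * y@_h) (g * h)%g.
Canonical grpmul_unlockable := Unlockable grpmul.unlock.

Section GroupAlgebra.
Variables (K : nzRingType) (G : groupType).
Local Notation grpU := (@grpU K G).
Local Notation grpmul := (@grpmul K G).
Implicit Types (x y z : grpalg K G) (g h : G).

Lemma grpmulw (d1 d2 : {fset G}) x y :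
  (msupp x `<=` d1)%fset -> (msupp y `<=` d2)%fset ->
  grpmul x y = \sum_(g <- d1) \sum_(h <- d2) grpmono (x@_g * y@_h) (g * h)%g.
Proof.
move=> le_d1 le_d2; rewrite grpmul.unlock (big_fset_incl _ le_d1) /=.
  apply/eq_bigr=> g _; apply/big_fset_incl => // h _ /mcoeff_outdom ->.
  by rewrite mulr0 grpmono0.
move=> g _ /mcoeff_outdom xg.
by rewrite big1 // => h _; rewrite xg mul0r grpmono0.
Qed.

Lemma grpmulDl : left_distributive grpmul +%R.
Proof.
move=> x y z; rewrite (grpmulw (fsubsetUl (msupp x) (msupp y)) (fsubset_refl _)).
rewrite (grpmulw (fsubsetUr (msupp x) (msupp y)) (fsubset_refl _)).
rewrite (grpmulw (grpsuppD x y) (fsubset_refl _)) -big_split /=.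
apply/eq_bigr=> g _; rewrite -big_split /=; apply/eq_bigr=> h _.
by rewrite grpcoeffD mulrDl grpmonoD.
Qed.

Lemma grpmulDr : right_distributive grpmul +%R.
Proof.
move=> z x y; rewrite (grpmulw (fsubset_refl _) (fsubsetUl (msupp x) (msupp y))).
rewrite (grpmulw (fsubset_refl _) (fsubsetUr (msupp x) (msupp y))).
rewrite (grpmulw (fsubset_refl _) (grpsuppD x y)) -big_split /=.
apply/eq_bigr=> g _; rewrite -big_split /=; apply/eq_bigr=> h _.
by rewrite grpcoeffD mulrDr grpmonoD.
Qed.

Lemma grpmul0x : left_zero 0 grpmul.
Proof. by move=> x; rewrite grpmul.unlock msupp0 big_seq_fset0. Qed.

Lemma grpmulx0 : right_zero 0 grpmul.
Proof. by move=> x; rewrite grpmul.unlock big1 // => g _; rewrite msupp0 big_seq_fset0. Qed.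

Lemma grpmulUU c d g h :
  grpmul (grpmono c g) (grpmono d h) = grpmono (c * d) (g * h)%g.
Proof. by rewrite (grpmulw (grpsuppU _ _) (grpsuppU _ _)) !big_seq_fset1 !grpcoeffUU. Qed.

Lemma grpmul_suml I (r : seq I) (F : I -> grpalg K G) y :
  grpmul (\sum_(i <- r) F i) y = \sum_(i <- r) grpmul (F i) y.
Proof.
exact: (big_morph (grpmul^~ y) (fun a b => grpmulDl a b y) (grpmul0x y)).
Qed.

Lemma grpmul_sumr I (r : seq I) (F : I -> grpalg K G) y :
  grpmul y (\sum_(i <- r) F i) = \sum_(i <- r) grpmul y (F i).
Proof.
exact: (big_morph (grpmul y) (fun a b => grpmulDr y a b) (grpmulx0 y)).
Qed.

Lemma grpalg_ind (P : grpalg K G -> Prop) :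
  P 0 -> (forall x y, P x -> P y -> P (x + y)) ->
  (forall c g, P (grpmono c g)) -> forall x, P x.
Proof. by move=> P0 PD PU x; rewrite [x]grpalgE; apply: big_ind. Qed.

Lemma grpmulA : associative grpmul.
Proof.
move=> x y z; elim/grpalg_ind: x => [|x x' IHx IHx'|c g].
- by rewrite !grpmul0x.
- by rewrite !grpmulDl IHx IHx'.
elim/grpalg_ind: y => [|y y' IHy IHy'|d h].
- by rewrite !(grpmulx0, grpmul0x).
- by rewrite !(grpmulDl, grpmulDr) IHy IHy'.
elim/grpalg_ind: z => [|z z' IHz IHz'|e k].
- by rewrite !grpmulx0.
- by rewrite !grpmulDr IHz IHz'.
by rewrite !grpmulUU mulrA mulgA.
Qed.

Lemma grpmul1x : left_id (grpU 1%g) grpmul.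
Proof.
move=> x; elim/grpalg_ind: x => [|x y IHx IHy|c g]; first exact: grpmulx0.
  by rewrite grpmulDr IHx IHy.
by rewrite grpmulUU mul1r mul1g.
Qed.

Lemma grpmulx1 : right_id (grpU 1%g) grpmul.
Proof.
move=> x; elim/grpalg_ind: x => [|x y IHx IHy|c g]; first exact: grpmul0x.
  by rewrite grpmulDl IHx IHy.
by rewrite grpmulUU mulr1 mulg1.
Qed.

Lemma grpalg_one_neq0 : grpU 1%g != 0 :> grpalg K G.
Proof.
apply/eqP => /(congr1 (mcoeff 1%g)); rewrite grpcoeffUU grpcoeff0.
by apply/eqP; rewrite oner_eq0.
Qed.

HB.instance Definition _ := GRing.Zmodule_isNzRing.Build (grpalg K G)
  grpmulA grpmul1x grpmulx1 grpmulDl grpmulDr grpalg_one_neq0.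

Lemma grpU1 : grpU 1%g = 1.
Proof. by []. Qed.

Lemma grpUM g h : grpU (g * h)%g = grpU g * grpU h.
Proof. by rewrite [RHS]grpmulUU mulr1. Qed.

Lemma grpalg_scaleU (c d : K) g :
  c *: grpmono d g = grpmono (c * d) g.
Proof. by apply/malgP => k; rewrite grpcoeffZ !grpcoeffU mulrnAr. Qed.

Lemma grpalg_mulUU c d g h :
  grpmono c g * grpmono d h = grpmono (c * d) (g * h)%g.
Proof. exact: grpmulUU. Qed.

Lemma grpalg_scaleAl (c : K) x y : c *: (x * y) = (c *: x) * y.
Proof.
elim/grpalg_ind: x => [|x x' IHx IHx'|d g].
- by rewrite mul0r !scaler0 mul0r.
- by rewrite mulrDl !scalerDr IHx IHx' mulrDl.
elim/grpalg_ind: y => [|y y' IHy IHy'|e h].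
- by rewrite !mulr0 scaler0.
- by rewrite !mulrDr scalerDr IHy IHy'.
by rewrite grpalg_scaleU !grpalg_mulUU grpalg_scaleU mulrA.
Qed.

HB.instance Definition _ :=
  GRing.Lmodule_isLalgebra.Build K (grpalg K G) grpalg_scaleAl.

End GroupAlgebra.

Arguments grpU {K G} g.

Section GroupAlgebraComm.
Variables (K : comNzRingType) (G : groupType).
Implicit Types (x y : grpalg K G).

Lemma grpalg_scaleAr (c : K) x y : c *: (x * y) = x * (c *: y).
Proof.
elim/grpalg_ind: x => [|x x' IHx IHx'|d g].
- by rewrite !mul0r scaler0.
- by rewrite !mulrDl scalerDr IHx IHx'.
elim/grpalg_ind: y => [|y y' IHy IHy'|e h].
- by rewrite !(mulr0, scaler0).
- by rewrite !(mulrDr, scalerDr) IHy IHy'.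
by rewrite grpalg_scaleU !grpalg_mulUU grpalg_scaleU mulrCA.
Qed.

HB.instance Definition _ :=
  GRing.Lalgebra_isAlgebra.Build K (grpalg K G) grpalg_scaleAr.

Section Lift.
Variables (A : algType K) (f : G -> A).
Hypothesis f1 : f 1%g = 1.
Hypothesis fM : forall g h, f (g * h)%g = f g * f h.

Definition grpalg_lift (x : grpalg K G) : A :=
  \sum_(g <- msupp x) x@_g *: f g.

Lemma grpalg_liftw (d : {fset G}) x : (msupp x `<=` d)%fset ->
  grpalg_lift x = \sum_(g <- d) x@_g *: f g.
Proof.
move=> le_d; rewrite /grpalg_lift (big_fset_incl _ le_d) //= => g _.
by move/mcoeff_outdom->; rewrite scale0r.
Qed.

Lemma grpalg_liftZU c g : grpalg_lift (grpmono c g) = c *: f g.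
Proof. by rewrite (grpalg_liftw (grpsuppU _ _)) big_seq_fset1 grpcoeffUU. Qed.

Lemma grpalg_liftU g : grpalg_lift (grpU g) = f g.
Proof. by rewrite grpalg_liftZU scale1r. Qed.

Lemma grpalg_lift_linear : linear grpalg_lift.
Proof.
move=> c x y; set d := (msupp x `|` msupp y)%fset.
have le_xd : (msupp x `<=` d)%fset by apply: fsubsetUl.
have le_yd : (msupp y `<=` d)%fset by apply: fsubsetUr.
have le_d : (msupp (c *: x + y) `<=` d)%fset.
  exact: fsubset_trans (grpsuppD _ _) (fsetSU _ (grpsuppZ _ _)).
rewrite !(grpalg_liftw le_xd, grpalg_liftw le_yd, grpalg_liftw le_d).
rewrite scaler_sumr -big_split /=; apply: eq_bigr => g _.
by rewrite grpcoeffD grpcoeffZ scalerDl scalerA.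
Qed.

Lemma grpalg_lift_monoid_morphism : monoid_morphism grpalg_lift.
Proof.
have lD u v : grpalg_lift (u + v) = grpalg_lift u + grpalg_lift v.
  by have := grpalg_lift_linear 1 u v; rewrite !scale1r.
have l0 : grpalg_lift 0 = 0 by rewrite /grpalg_lift msupp0 big_seq_fset0.
split=> [|x y]; first by rewrite -grpU1 grpalg_liftU f1.
elim/grpalg_ind: x => [|x x' IHx IHx'|c g].
- by rewrite !(mul0r, l0).
- by rewrite mulrDl !lD IHx IHx' mulrDl.
elim/grpalg_ind: y => [|y y' IHy IHy'|e h].
- by rewrite !(mulr0, l0).
- by rewrite mulrDr !lD IHy IHy' mulrDr.
rewrite grpalg_mulUU !grpalg_liftZU fM.
by rewrite -scalerAl -scalerAr scalerA.
Qed.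

End Lift.

End GroupAlgebraComm.

(** [Z[a^±1, b^±1, c^±1]] is the group algebra over [int] of the free abelian
   group on three generators, written multiplicatively: the triple [(i, j, k)]
   of integers stands for the monomial [a^i b^j c^k]. *)

Definition laurent_mon : Type := (int * int * int)%type.

HB.instance Definition _ := Choice.on laurent_mon.
HB.instance Definition _ := isGroup.Build laurent_mon
  (@addrA (int * int * int)%type) (@add0r (int * int * int)%type)
  (@addr0 (int * int * int)%type) (@addNr (int * int * int)%type)
  (@addrN (int * int * int)%type).

Definition laurent : Type := grpalg int laurent_mon.

HB.instance Definition _ := GRing.NzRing.on laurent.

Lemma laurent_mulC : commutative (@GRing.mul laurent).
Proof.
move=> x y; elim/grpalg_ind: x => [|x x' IHx IHx'|c g].
- by rewrite mul0r mulr0.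
- by rewrite mulrDl mulrDr IHx IHx'.
elim/grpalg_ind: y => [|y y' IHy IHy'|d h].
- by rewrite mul0r mulr0.
- by rewrite mulrDl mulrDr IHy IHy'.
rewrite [LHS]grpalg_mulUU [RHS]grpalg_mulUU mulrC; congr (grpmono _ _).
exact: (@addrC (int * int * int)%type).
Qed.

HB.instance Definition _ :=
  GRing.PzRing_hasCommutativeMul.Build laurent laurent_mulC.

Definition laurent_unit : {pred laurent} :=
  fun x => `[< exists y : laurent, y * x = 1 >].

Definition laurent_inv (x : laurent) : laurent :=
  if pselect (exists y : laurent, y * x = 1) is left ex
  then projT1 (cid ex) else x.

Lemma laurent_mulVx : {in laurent_unit, left_inverse 1 laurent_inv *%R}.
Proof.
move=> x /asboolP ux; rewrite /laurent_inv.
by case: pselect => // ex; case: cid.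
Qed.

Lemma laurent_unitPl (x y : laurent) : y * x = 1 -> x \in laurent_unit.
Proof. by move=> yx1; apply/asboolP; exists y. Qed.

Lemma laurent_invx_out : {in [predC laurent_unit], laurent_inv =1 id}.
Proof.
move=> x; rewrite inE /= => /asboolP nux; rewrite /laurent_inv.
by case: pselect.
Qed.

HB.instance Definition _ := GRing.ComNzRing_hasMulInverse.Build laurent
  laurent_mulVx laurent_unitPl laurent_invx_out.

Definition laurentX (i j k : int) : laurent :=
  grpU ((i, j, k) : laurent_mon).

Definition La : laurent := laurentX 1 0 0.
Definition Lb : laurent := laurentX 0 1 0.
Definition Lc : laurent := laurentX 0 0 1.

Lemma laurentXM i j k i' j' k' :
  laurentX i j k * laurentX i' j' k' = laurentX (i + i') (j + j') (k + k').
Proof. by rewrite /laurentX -grpUM. Qed.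

Lemma laurentX_unit i j k : laurentX i j k \is a GRing.unit.
Proof.
by apply: (@laurent_unitPl _ (laurentX (- i) (- j) (- k))); rewrite laurentXM !addNr.
Qed.

Lemma laurentXV i j k : (laurentX i j k)^-1 = laurentX (- i) (- j) (- k).
Proof.
by apply: (mulrI (laurentX_unit i j k)); rewrite divrr ?laurentX_unit // laurentXM !addrN.
Qed.

Section QuotientAlgebra.
Variables (K : comNzRingType) (A : algType K) (S : A -> Prop).

Inductive ideal_gen : A -> Prop :=
| IdealGen x : S x -> ideal_gen x
| Ideal0 : ideal_gen 0
| IdealD x y : ideal_gen x -> ideal_gen y -> ideal_gen (x + y)
| IdealMl x y : ideal_gen y -> ideal_gen (x * y)
| IdealMr x y : ideal_gen x -> ideal_gen (x * y).

Lemma ideal_genN x : ideal_gen x -> ideal_gen (- x).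
Proof. by move=> Ix; rewrite -mulN1r; apply: IdealMl. Qed.

Lemma ideal_genZ (c : K) x : ideal_gen x -> ideal_gen (c *: x).
Proof. by move=> Ix; rewrite -mulr_algl; apply: IdealMl. Qed.

Definition ideal_eqb (x y : A) : bool := `[< ideal_gen (x - y) >].

Lemma ideal_eqb_refl : reflexive ideal_eqb.
Proof. by move=> x; apply/asboolP; rewrite subrr; apply: Ideal0. Qed.

Lemma ideal_eqb_sym : symmetric ideal_eqb.
Proof.
by move=> x y; apply/asboolP/asboolP => /ideal_genN; rewrite opprB.
Qed.

Lemma ideal_eqb_trans : transitive ideal_eqb.
Proof.
move=> y x z /asboolP xy /asboolP yz; apply/asboolP.
by rewrite -(subrKA y); apply: IdealD.
Qed.

Canonical ideal_equiv := EquivRel ideal_eqb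
  ideal_eqb_refl ideal_eqb_sym ideal_eqb_trans.

Definition quot_alg : Type := {eq_quot ideal_equiv}.

HB.instance Definition _ := Choice.on quot_alg.
HB.instance Definition _ := EqQuotient.on quot_alg.

End QuotientAlgebra.

HB.lock Definition quot_pi (K : comNzRingType) (A : algType K)
    (S : A -> Prop) (x : A) : quot_alg S := \pi_(quot_alg S) x.
Canonical quot_pi_unlockable := Unlockable quot_pi.unlock.

Arguments IdealGen {K A S x}.
Arguments Ideal0 {K A S}.
Arguments IdealD {K A S x y}.
Arguments IdealMl {K A S} x {y}.
Arguments IdealMr {K A S x} y.

Section QuotientAlgebraTheory.
Variables (K : comNzRingType) (A : algType K) (S : A -> Prop).
Local Notation ideal_gen := (@ideal_gen K A S).
Local Notation quot_alg := (@quot_alg K A S).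
Local Notation quot_pi := (@quot_pi K A S).

Lemma quot_piP x y : ideal_gen (x - y) <-> quot_pi x = quot_pi y.
Proof.
rewrite unlock; split=> [xy|/eqP].
  by apply/eqP; rewrite piE; apply/asboolP.
by rewrite piE => /asboolP.
Qed.

Lemma quot_piK (x : quot_alg) : quot_pi (repr x) = x.
Proof. by rewrite unlock reprK. Qed.

Lemma quot_pi_ind (P : quot_alg -> Prop) :
  (forall x, P (quot_pi x)) -> forall x, P x.
Proof. by move=> Ppi x; rewrite -[x]quot_piK. Qed.

Definition quot_opp (x : quot_alg) := quot_pi (- repr x).
Definition quot_add (x y : quot_alg) := quot_pi (repr x + repr y).
Definition quot_mul (x y : quot_alg) := quot_pi (repr x * repr y).
Definition quot_scale (c : K) (x : quot_alg) := quot_pi (c *: repr x).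

Lemma repr_quot_pi x : ideal_gen (repr (quot_pi x) - x).
Proof. exact/quot_piP/quot_piK. Qed.

Lemma quot_oppE x : quot_opp (quot_pi x) = quot_pi (- x).
Proof.
apply/quot_piP; rewrite -opprD; apply: ideal_genN; exact: repr_quot_pi.
Qed.

Lemma quot_addE x y : quot_add (quot_pi x) (quot_pi y) = quot_pi (x + y).
Proof.
by apply/quot_piP; rewrite opprD addrACA; apply: IdealD; apply: repr_quot_pi.
Qed.

Lemma quot_mulE x y : quot_mul (quot_pi x) (quot_pi y) = quot_pi (x * y).
Proof.
apply/quot_piP; rewrite -(subrKA (x * repr (quot_pi y))) -mulrBl -mulrBr.
by apply: IdealD; [apply: IdealMr | apply: IdealMl]; apply: repr_quot_pi.
Qed.

Lemma quot_scaleE c x : quot_scale c (quot_pi x) = quot_pi (c *: x).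
Proof.
by apply/quot_piP; rewrite -scalerBr; apply: ideal_genZ; apply: repr_quot_pi.
Qed.

Lemma quot_addA : associative quot_add.
Proof.
elim/quot_pi_ind=> x; elim/quot_pi_ind=> y; elim/quot_pi_ind=> z.
by rewrite !quot_addE addrA.
Qed.

Lemma quot_addC : commutative quot_add.
Proof.
by elim/quot_pi_ind=> x; elim/quot_pi_ind=> y; rewrite !quot_addE addrC.
Qed.

Lemma quot_add0 : left_id (quot_pi 0) quot_add.
Proof. by elim/quot_pi_ind=> x; rewrite quot_addE add0r. Qed.

Lemma quot_addN : left_inverse (quot_pi 0) quot_opp quot_add.
Proof. by elim/quot_pi_ind=> x; rewrite quot_oppE quot_addE addNr. Qed.

HB.instance Definition _ := GRing.isZmodule.Build quot_alg
  quot_addA quot_addC quot_add0 quot_addN.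

Lemma quot_mulA : associative quot_mul.
Proof.
elim/quot_pi_ind=> x; elim/quot_pi_ind=> y; elim/quot_pi_ind=> z.
by rewrite !quot_mulE mulrA.
Qed.

Lemma quot_mul1x : left_id (quot_pi 1) quot_mul.
Proof. by elim/quot_pi_ind=> x; rewrite quot_mulE mul1r. Qed.

Lemma quot_mulx1 : right_id (quot_pi 1) quot_mul.
Proof. by elim/quot_pi_ind=> x; rewrite quot_mulE mulr1. Qed.

Lemma quot_mulDl : left_distributive quot_mul +%R.
Proof.
elim/quot_pi_ind=> x; elim/quot_pi_ind=> y; elim/quot_pi_ind=> z.
by rewrite [X in quot_mul X _]quot_addE !quot_mulE mulrDl -quot_addE.
Qed.

Lemma quot_mulDr : right_distributive quot_mul +%R.
Proof.
elim/quot_pi_ind=> x; elim/quot_pi_ind=> y; elim/quot_pi_ind=> z.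
by rewrite [X in quot_mul _ X]quot_addE !quot_mulE mulrDr -quot_addE.
Qed.

HB.instance Definition _ := GRing.Zmodule_isPzRing.Build quot_alg
  quot_mulA quot_mul1x quot_mulx1 quot_mulDl quot_mulDr.

Lemma quot_scaleA c d x :
  quot_scale c (quot_scale d x) = quot_scale (c * d) x.
Proof. by elim/quot_pi_ind: x => x; rewrite !quot_scaleE scalerA. Qed.

Lemma quot_scale1 : left_id 1 quot_scale.
Proof. by elim/quot_pi_ind=> x; rewrite quot_scaleE scale1r. Qed.

Lemma quot_scaleDr : right_distributive quot_scale +%R.
Proof.
move=> c; elim/quot_pi_ind=> x; elim/quot_pi_ind=> y.
by rewrite [X in quot_scale _ X]quot_addE !quot_scaleE scalerDr -quot_addE.
Qed.

Lemma quot_scaleDl x : {morph quot_scale^~ x : c d / c + d}.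
Proof.
elim/quot_pi_ind: x => x c d.
by rewrite /= !quot_scaleE scalerDl -quot_addE.
Qed.

HB.instance Definition _ := GRing.Zmodule_isLmodule.Build K quot_alg
  quot_scaleA quot_scale1 quot_scaleDr quot_scaleDl.

Lemma quot_piD x y : quot_pi (x + y) = quot_pi x + quot_pi y.
Proof. by rewrite -quot_addE. Qed.

Lemma quot_piN x : quot_pi (- x) = - quot_pi x.
Proof. by rewrite -quot_oppE. Qed.

Lemma quot_piM x y : quot_pi (x * y) = quot_pi x * quot_pi y.
Proof. by rewrite -quot_mulE. Qed.

Lemma quot_piZ c x : quot_pi (c *: x) = c *: quot_pi x.
Proof. by rewrite -quot_scaleE. Qed.

Lemma quot_scaleAl (c : K) (x y : quot_alg) : c *: (x * y) = (c *: x) * y.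
Proof.
elim/quot_pi_ind: x => x; elim/quot_pi_ind: y => y.
by rewrite -(quot_piZ c x) -!quot_piM -quot_piZ scalerAl.
Qed.

Lemma quot_scaleAr (c : K) (x y : quot_alg) : c *: (x * y) = x * (c *: y).
Proof.
elim/quot_pi_ind: x => x; elim/quot_pi_ind: y => y.
by rewrite -(quot_piZ c y) -!quot_piM -quot_piZ scalerAr.
Qed.

Lemma quot_pi_linear : linear quot_pi.
Proof. by move=> c x y; rewrite quot_piD quot_piZ. Qed.

Lemma quot_pi_monoid_morphism : monoid_morphism quot_pi.
Proof. by split; last exact: quot_piM. Qed.

Lemma quot_pi0P x : quot_pi x = 0 <-> ideal_gen x.
Proof. by have := quot_piP x 0; rewrite subr0 => xP; apply: iff_sym. Qed.

End QuotientAlgebraTheory.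

Section QuotientLift.
Variables (K : comNzRingType) (A : algType K) (S : A -> Prop).
Variables (B : pzRingType) (f : {rmorphism A -> B}).
Hypothesis fS : forall x, S x -> f x = 0.

Lemma ideal_gen_ker x : ideal_gen S x -> f x = 0.
Proof.
elim=> {x} [x /fS //||x y _ fx _ fy|x y _ fy|x y _ fx].
- exact: rmorph0.
- by rewrite rmorphD fx fy addr0.
- by rewrite rmorphM fy mulr0.
- by rewrite rmorphM fx mul0r.
Qed.

Lemma quot_lift_repr x : f (repr (quot_pi S x)) = f x.
Proof.
by apply/eqP; rewrite -subr_eq0 -rmorphB; apply/eqP/ideal_gen_ker/repr_quot_pi.
Qed.

End QuotientLift.

(** [B_n] has generators indexed by ['I_n.-1]; the index [i] (counted from 0)
   is that of the Artin generator [s_{i+1}]. *)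

Section Braid.
Variable n : nat.

Inductive braid_rel : word 'I_n.-1 -> word 'I_n.-1 -> Prop :=
| BraidFar (i j : 'I_n.-1) : (i.+1 < j)%N ->
    braid_rel [:: (i, true); (j, true)] [:: (j, true); (i, true)]
| BraidNear (i j : 'I_n.-1) : i.+1 = j :> nat ->
    braid_rel [:: (i, true); (j, true); (i, true)]
              [:: (j, true); (i, true); (j, true)].

Definition braid : Type := pres_group braid_rel.

HB.instance Definition _ := Group.on braid.

Definition artin (i : 'I_n.-1) : braid := pres_gen braid_rel i.

Lemma artin_far (i j : 'I_n.-1) : (i.+1 < j)%N -> (artin i * artin j = artin j * artin i)%g.
Proof.
move=> ij; apply: etrans (pres_classM _ _ _).
apply: etrans (esym (pres_classM _ _ _)) _.
exact/pres_classP/PresRel/BraidFar.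
Qed.

Lemma artin_near (i j : 'I_n.-1) : i.+1 = j :> nat ->
  (artin i * (artin j * artin i) = artin j * (artin i * artin j))%g.
Proof.
move=> ij; have E k l : (artin k * (artin l * artin k))%g =
    pres_class braid_rel ([:: (k, true)] ++ ([:: (l, true)] ++ [:: (k, true)])).
  by rewrite !pres_classM.
rewrite [LHS]E [RHS]E; exact/pres_classP/PresRel/BraidNear.
Qed.

End Braid.

Section BraidInclusion.
Variable n : nat.

Definition braid_incl_letter (l : 'I_n.-1 * bool) : braid n.+1 :=
  let s := @artin n.+1 (widen_ord (leq_pred n) l.1) in
  if l.2 then s else s^-1%g.

Definition braid_incl : braid n -> braid n.+1 :=
  pres_lift *%g braid_incl_letter.

Lemma braid_incl_rel u v : braid_rel u v ->
  \big[*%g/1%g]_(l <- u) braid_incl_letter l =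
  \big[*%g/1%g]_(l <- v) braid_incl_letter l.
Proof.
case=> i j ij; rewrite !big_cons !big_nil /= !mulg1 /braid_incl_letter /=.
  exact: (@artin_far n.+1).
exact: (@artin_near n.+1).
Qed.

Lemma braid_incl_letterV x b :
  (braid_incl_letter (x, b) * braid_incl_letter (x, ~~ b) = 1)%g.
Proof. by case: b; rewrite /braid_incl_letter /= ?mulgV ?mulVg. Qed.

Lemma braid_incl1 : braid_incl 1%g = 1%g.
Proof. exact: (pres_lift1 braid_incl_rel braid_incl_letterV). Qed.

Lemma braid_inclM x y : braid_incl (x * y)%g = (braid_incl x * braid_incl y)%g.
Proof. exact: (pres_liftM braid_incl_rel braid_incl_letterV). Qed.

Lemma braid_incl_artin i :
  braid_incl (artin i) = @artin n.+1 (widen_ord (leq_pred n) i).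
Proof. exact: (pres_lift_gen braid_incl_rel braid_incl_letterV). Qed.

Lemma braid_inclV x : braid_incl x^-1%g = (braid_incl x)^-1%g.
Proof.
by apply: (mulgI (braid_incl x)); rewrite -braid_inclM !mulgV braid_incl1.
Qed.

End BraidInclusion.

Section Qdef.
Variable n : nat.

Definition braid_alg : Type := grpalg laurent (braid n).

HB.instance Definition _ := GRing.Algebra.on braid_alg.

Definition braidU (g : braid n) : braid_alg := grpU g.

Definition cubic (s : braid n) : braid_alg :=
  (braidU s - La%:A) * (braidU s - Lb%:A) * (braidU s - Lc%:A).

Definition Qrhs (s1 s2 : braid n) : braid_alg :=
  (  braidU (s1 * s2 * s1^-1)%g
   - La^-1 *: braidU (s1 * s2)%g
   + La *: braidU (s1 * s2^-1)%g
   + La *: braidU (s1^-1 * s2)%g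
   - La ^+ 3 *: braidU (s1^-1 * s2^-1)%g
   + La^-1 *: braidU (s2 * s1)%g
   - La *: braidU (s2 * s1^-1)%g
   - La *: braidU (s2^-1 * s1)%g
   + La ^+ 3 *: braidU (s2^-1 * s1^-1)%g
   + La ^+ 2 *: braidU (s1^-1 * s2^-1 * s1)%g
   - La ^+ 2 *: braidU (s1 * s2^-1 * s1^-1)%g).

Section Morph.
Variables (A : algType laurent) (f : {lrmorphism braid_alg -> A}).

Lemma morph_scalar (c : laurent) : f c%:A = c%:A.
Proof. by rewrite linearZ /= rmorph1. Qed.

Lemma cubic_morph s : f (cubic s) =
  (f (braidU s) - La%:A) * (f (braidU s) - Lb%:A) * (f (braidU s) - Lc%:A).
Proof. by rewrite /cubic 2!rmorphM 3!rmorphB -3!morph_scalar. Qed.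

Lemma Qrhs_morph s1 s2 : f (Qrhs s1 s2) =
     f (braidU (s1 * s2 * s1^-1)%g)
   - La^-1 *: f (braidU (s1 * s2)%g)
   + La *: f (braidU (s1 * s2^-1)%g)
   + La *: f (braidU (s1^-1 * s2)%g)
   - La ^+ 3 *: f (braidU (s1^-1 * s2^-1)%g)
   + La^-1 *: f (braidU (s2 * s1)%g)
   - La *: f (braidU (s2 * s1^-1)%g)
   - La *: f (braidU (s2^-1 * s1)%g)
   + La ^+ 3 *: f (braidU (s2^-1 * s1^-1)%g)
   + La ^+ 2 *: f (braidU (s1^-1 * s2^-1 * s1)%g)
   - La ^+ 2 *: f (braidU (s1 * s2^-1 * s1^-1)%g).
Proof. by rewrite /Qrhs !(linearB, linearD, linearZ). Qed.

End Morph.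

(* [QrelBraid] is vacuous unless [3 <= n], and both are for [n < 2]. *)
Inductive Qrel : braid_alg -> Prop :=
| QrelCubic (i : 'I_n.-1) : i = 0%N :> nat -> Qrel (cubic (artin i))
| QrelBraid (i j : 'I_n.-1) : i = 0%N :> nat -> j = 1%N :> nat ->
    Qrel (braidU ((artin i)^-1 * artin j * artin i)%g
          - Qrhs (artin i) (artin j)).

Definition Q : Type := quot_alg Qrel.

HB.instance Definition _ := GRing.Lmodule.on Q.
HB.instance Definition _ := GRing.PzRing.on Q.

(* [Q_n] is non-zero: it has the character [s_i |-> a]. *)

Definition Qchar_letter (l : 'I_n.-1 * bool) : laurent :=
  if l.2 then La else La^-1.

Definition Qchar_braid : braid n -> laurent^o := pres_lift *%R Qchar_letter.

Lemma Qchar_rel u v : braid_rel u v ->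
  \prod_(l <- u) Qchar_letter l = \prod_(l <- v) Qchar_letter l.
Proof. by case=> i j ij; rewrite !big_cons !big_nil. Qed.

Lemma Qchar_letterV x b : Qchar_letter (x, b) * Qchar_letter (x, ~~ b) = 1.
Proof.
by case: b; rewrite /Qchar_letter /= ?mulrV ?mulVr ?laurentX_unit.
Qed.

Lemma Qchar_braid1 : Qchar_braid 1%g = 1.
Proof. exact: (pres_lift1 Qchar_rel Qchar_letterV). Qed.

Lemma Qchar_braidM g h : Qchar_braid (g * h)%g = Qchar_braid g * Qchar_braid h.
Proof. exact: (pres_liftM Qchar_rel Qchar_letterV). Qed.

Lemma Qchar_artin i : Qchar_braid (artin i) = La.
Proof. exact: (pres_lift_gen Qchar_rel Qchar_letterV). Qed.

Lemma Qchar_artinV i : Qchar_braid (artin i)^-1%g = La^-1.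
Proof. exact: (pres_lift_genV Qchar_rel Qchar_letterV). Qed.

Lemma Qchar_identity (K : comNzRingType) (a b : K) :
  b * a * a =
    a * a * b - b * (a * a) + a * (a * b) + a * (b * a) - a ^+ 3 * (b * b)
    + b * (a * a) - a * (a * b) - a * (b * a) + a ^+ 3 * (b * b)
    + a ^+ 2 * (b * b * a) - a ^+ 2 * (a * b * b).
Proof. by ring. Qed.

Definition Qchar : braid_alg -> laurent^o := grpalg_lift Qchar_braid.

HB.instance Definition _ := GRing.isLinear.Build laurent braid_alg laurent^o
  *:%R Qchar (grpalg_lift_linear Qchar_braid).
HB.instance Definition _ := GRing.isMonoidMorphism.Build braid_alg laurent^o
  Qchar (grpalg_lift_monoid_morphism Qchar_braid1 Qchar_braidM).

Lemma QcharU g : Qchar (braidU g) = Qchar_braid g.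
Proof. exact: grpalg_liftU. Qed.

Lemma Qchar_Qrel x : Qrel x -> Qchar x = 0.
Proof.
pose f : {lrmorphism braid_alg -> laurent^o} := Qchar.
have scale1 (c : laurent) : c%:A = c :> laurent^o by apply: mulr1.
case=> {x} [i _|i j _ _].
  rewrite -[Qchar _]/(f _) cubic_morph -[f (braidU _)]/(Qchar _).
  by rewrite QcharU Qchar_artin !scale1 subrr !mul0r.
have fB x y : f (x - y) = f x - f y by apply: linearB.
rewrite -[Qchar _]/(f _) fB Qrhs_morph.
have fU g : f (braidU g) = Qchar_braid g := QcharU g.
rewrite !fU !Qchar_braidM !Qchar_artin !Qchar_artinV; apply/eqP.
rewrite subr_eq0; apply/eqP; exact: Qchar_identity.
Qed.

Lemma Q_one_neq0 : (1 : Q) != 0.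
Proof.
apply/eqP => /quot_pi0P /(ideal_gen_ker Qchar_Qrel) /eqP.
by rewrite rmorph1 oner_eq0.
Qed.

HB.instance Definition _ := GRing.PzSemiRing_isNonZero.Build Q Q_one_neq0.
HB.instance Definition _ := GRing.Lmodule_isLalgebra.Build laurent Q
  (@quot_scaleAl _ _ Qrel).
HB.instance Definition _ := GRing.Lalgebra_isAlgebra.Build laurent Q
  (@quot_scaleAr _ _ Qrel).

Definition Qpi (x : braid_alg) : Q := quot_pi Qrel x.

HB.instance Definition _ := GRing.isLinear.Build laurent braid_alg Q *:%R Qpi
  (@quot_pi_linear _ _ Qrel).
HB.instance Definition _ := GRing.isMonoidMorphism.Build braid_alg Q Qpi
  (@quot_pi_monoid_morphism _ _ Qrel).

Lemma Qpi_eq0 x : Qrel x -> Qpi x = 0.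
Proof. by move=> xQ; apply/quot_pi0P/IdealGen. Qed.

Lemma QpiK (x : Q) : Qpi (repr x) = x.
Proof. exact: quot_piK. Qed.

Definition Qbraid (g : braid n) : Q := Qpi (braidU g).

Lemma Qbraid1 : Qbraid 1%g = 1.
Proof. exact: rmorph1. Qed.

Lemma QbraidM g h : Qbraid (g * h)%g = Qbraid g * Qbraid h.
Proof. by rewrite /Qbraid /braidU grpUM; apply: (rmorphM Qpi). Qed.

End Qdef.

Section QInclusion.
Variable n : nat.

Definition braid_alg_incl : braid_alg n -> braid_alg n.+1 :=
  grpalg_lift (fun g => braidU (braid_incl g)).

Lemma braid_alg_incl_braid1 : braidU (@braid_incl n 1%g) = 1.
Proof. by rewrite braid_incl1. Qed.

Lemma braid_alg_incl_braidM (g h : braid n) :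
  braidU (braid_incl (g * h)%g) = braidU (braid_incl g) * braidU (braid_incl h).
Proof. by rewrite braid_inclM /braidU grpUM. Qed.

HB.instance Definition _ := GRing.isLinear.Build laurent
  (braid_alg n) (braid_alg n.+1) *:%R braid_alg_incl
  (grpalg_lift_linear (fun g => braidU (braid_incl g))).
HB.instance Definition _ := GRing.isMonoidMorphism.Build
  (braid_alg n) (braid_alg n.+1) braid_alg_incl
  (grpalg_lift_monoid_morphism braid_alg_incl_braid1 braid_alg_incl_braidM).

Lemma braid_alg_inclU g : braid_alg_incl (braidU g) = braidU (braid_incl g).
Proof. exact: grpalg_liftU. Qed.

Lemma braid_alg_incl_cubic s :
  braid_alg_incl (cubic s) = cubic (braid_incl s).
Proof.
apply: etrans (cubic_morph (braid_alg_incl : {lrmorphism _ -> _}) s) _.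
by rewrite /= !braid_alg_inclU.
Qed.

Lemma braid_alg_incl_Qrhs s1 s2 :
  braid_alg_incl (Qrhs s1 s2) = Qrhs (braid_incl s1) (braid_incl s2).
Proof.
apply: etrans (Qrhs_morph (braid_alg_incl : {lrmorphism _ -> _}) s1 s2) _.
by rewrite /= !braid_alg_inclU !(braid_inclM, braid_inclV).
Qed.

Definition Qincl_lift : braid_alg n -> Q n.+1 := @Qpi n.+1 \o braid_alg_incl.

HB.instance Definition _ := GRing.LRMorphism.on Qincl_lift.

Lemma Qincl_lift_Qrel x : Qrel x -> Qincl_lift x = 0.
Proof.
move=> xQ; apply: Qpi_eq0; case: xQ => {x} [i i0|i j i0 j1].
  by rewrite braid_alg_incl_cubic braid_incl_artin; apply: QrelCubic.
rewrite [braid_alg_incl _]linearB /= braid_alg_incl_Qrhs braid_alg_inclU.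
by rewrite !braid_inclM braid_inclV !braid_incl_artin; apply: QrelBraid.
Qed.

Definition Qincl (x : Q n) : Q n.+1 := Qincl_lift (repr x).

Lemma Qincl_pi x : Qincl (Qpi x) = Qincl_lift x.
Proof. exact: (quot_lift_repr Qincl_lift_Qrel). Qed.

Lemma Qincl_is_linear : linear Qincl.
Proof.
move=> c x y; rewrite -[x]QpiK -[y]QpiK.
rewrite (_ : c *: Qpi (repr x) + Qpi (repr y) = Qpi (c *: repr x + repr y)).
  by rewrite !Qincl_pi; apply: linearP.
by apply: esym; apply: linearP.
Qed.

Lemma Qincl_is_monoid_morphism : monoid_morphism Qincl.
Proof.
split=> [|x y].
  rewrite (_ : 1 = Qpi 1) ?Qincl_pi; first exact: (rmorph1 Qincl_lift).
  by apply: esym; apply: rmorph1.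
rewrite -[x]QpiK -[y]QpiK.
rewrite (_ : Qpi (repr x) * Qpi (repr y) = Qpi (repr x * repr y)).
  by rewrite !Qincl_pi; apply: (rmorphM Qincl_lift).
by apply: esym; apply: rmorphM.
Qed.

HB.instance Definition _ := GRing.isLinear.Build laurent (Q n) (Q n.+1)
  *:%R Qincl Qincl_is_linear.
HB.instance Definition _ := GRing.isMonoidMorphism.Build (Q n) (Q n.+1)
  Qincl Qincl_is_monoid_morphism.

Lemma Qincl_braid g : Qincl (Qbraid g) = Qbraid (braid_incl g).
Proof. by rewrite Qincl_pi /Qincl_lift /= braid_alg_inclU. Qed.

End QInclusion.

Definition free_of_rank (K : comNzRingType) (V : lmodType K) (r : nat) : Prop :=
  exists e : 'I_r -> V, forall v : V,
    exists! c : {ffun 'I_r -> K}, v = \sum_(i < r) c i *: e i.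

Local Open Scope classical_set_scope.

Definition lspan (K : comNzRingType) (V : lmodType K) (S : set V) : set V :=
  [set v | exists (m : nat) (c : 'I_m -> K) (e : 'I_m -> V),
     (forall i, S (e i)) /\ v = \sum_(i < m) c i *: e i].

Definition addset (V : zmodType) (X Y : set V) : set V :=
  [set x + y | x in X & y in Y].

Notation "X :+: Y" := (addset X Y)
  (at level 50, left associativity) : classical_set_scope.

(** Written [XyZ] in the literature. *)
Definition prodspan (K : comNzRingType) (A : algType K) (X : set A) (y : A)
    (Z : set A) : set A :=
  lspan [set x * y * z | x in X & z in Z].

(** [Q_2] is identified with the subalgebra of [Q_3] generated by [s_1]; the
   inverse of [s_1] need not be added, because [a b c] is a unit. *)

Inductive subalg_gen (K : comNzRingType) (A : algType K) (S : set A) : A -> Prop :=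
| SubalgGen x : S x -> subalg_gen S x
| Subalg1 : subalg_gen S 1
| SubalgZ (c : K) x : subalg_gen S x -> subalg_gen S (c *: x)
| SubalgD x y : subalg_gen S x -> subalg_gen S y -> subalg_gen S (x + y)
| SubalgM x y : subalg_gen S x -> subalg_gen S y -> subalg_gen S (x * y).

Lemma Qcubic n (i : 'I_n.-1) : i = 0%N :> nat ->
  (Qbraid (artin i) - La%:A) * (Qbraid (artin i) - Lb%:A)
  * (Qbraid (artin i) - Lc%:A) = 0.
Proof.
move=> i0; rewrite -[RHS](Qpi_eq0 (QrelCubic i0)).
exact: esym (cubic_morph (@Qpi n : {lrmorphism _ -> _}) (artin i)).
Qed.

Lemma Qbraid_artinV n (i : 'I_n.-1) : i = 0%N :> nat ->
  let s := Qbraid (artin i) in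
  Qbraid (artin i)^-1%g = (La * Lb * Lc)^-1 *:
    (s * s + (- (La + Lb + Lc)) *: s + (La * Lb + La * Lc + Lb * Lc)%:A).
Proof.
move=> i0 s; set t := Qbraid _^-1%g; set p := (X in _ *: X).
have uabc : La * Lb * Lc \is a GRing.unit by rewrite !unitrM !laurentX_unit.
have ts : t * s = 1 by rewrite -QbraidM mulVg Qbraid1.
have ps : p * s = (La * Lb * Lc)%:A.
  apply/eqP; rewrite -subr_eq0 -(Qcubic i0) -/s; apply/eqP.
  rewrite !(mulrBl, mulrBr, mulrDl, mulrDr, =^~ scalerAl, =^~ scalerAr).
  rewrite !(mulr1, mul1r, scalerA, scalerDl, scaleNr).
  rewrite !opprD !opprK !addrA.
  by rewrite [LHS](ACl (1*3*2*5*4*7*6*8)%AC).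
have st : s * t = 1 by rewrite -QbraidM mulgV Qbraid1.
have -> : p = (La * Lb * Lc) *: t.
  by rewrite -[p]mulr1 -st mulrA ps -scalerAl mul1r.
by rewrite scalerA mulVr // scale1r.
Qed.

Lemma range_Qincl2 : let s1 := Qbraid (@artin 3 (@ord0 1)) in
  range (@Qincl 2) = [set x | subalg_gen [set s1] x].
Proof.
move=> s1; apply/seteqP; split=> [_ [x _ <-]|x] /=.
  rewrite -[x]QpiK; elim/grpalg_ind: (repr x) => [|u v IHu IHv|c g].
  - rewrite [Qpi 0]linear0 [Qincl 0]linear0 -(scale0r 1).
    by apply: SubalgZ; apply: Subalg1.
  - by rewrite [Qpi _]linearD [Qincl _]linearD; apply: SubalgD.
  rewrite (_ : grpmono c g = c *: braidU g); last first.
    by rewrite /braidU /grpU grpalg_scaleU mulr1.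
  rewrite [Qpi _]linearZ [Qincl _]linearZ /=; apply: SubalgZ.
  rewrite -[Qpi _]/(Qbraid g) Qincl_braid -[g]pres_classK.
  elim: (repr g) => [|[i b] w IHw].
    rewrite pres_class1 braid_incl1 Qbraid1; exact: Subalg1.
  rewrite -cat1s pres_classM braid_inclM QbraidM; apply: SubalgM => //.
  have -> : i = ord0 by apply/val_inj; case: i => [[|[]]].
  have wd : widen_ord (leq_pred 2) (ord0 : 'I_1) = ord0 :> 'I_2 by apply/val_inj.
  have gs : subalg_gen [set s1] s1 by apply: SubalgGen.
  case: b.
    by rewrite -[pres_class _ _]/(artin _) braid_incl_artin wd.
  rewrite -pres_genV braid_inclV -[pres_gen _ _]/(artin _) braid_incl_artin wd.
  rewrite Qbraid_artinV //.
  apply: SubalgZ; apply: SubalgD; last by apply: SubalgZ; apply: Subalg1.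
  by apply: SubalgD; [apply: SubalgM | apply: SubalgZ].
elim=> {x} [_ ->||c x _ [y _ <-]|x y _ [x' _ <-] _ [y' _ <-]
           |x y _ [x' _ <-] _ [y' _ <-]].
- exists (Qbraid (@artin 2 (@ord0 0))) => //.
  rewrite Qincl_braid braid_incl_artin; congr (Qbraid (artin _)).
  exact/val_inj.
- by exists 1 => //; apply: rmorph1.
- by exists (c *: y) => //; apply: linearZ.
- by exists (x' + y') => //; apply: linearD.
- by exists (x' * y') => //; apply: rmorphM.
Qed.

(* Main.v *)
(* Completing the defining relations of Q_3 into a rewriting system on words in
   s_1, s_2 and their inverses (every relation met on the way can be solved for
   its leading word, whose coefficient is a unit) leaves 20 irreducible words,
   which therefore span Q_3. Left multiplication on these words is described by
   20 x 20 matrices over R; as these satisfy the defining relations, they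
   define a representation of Q_3 in which the k-th word sends the first basis
   vector (that of the empty word) to the k-th one, so the words are linearly
   independent. Q_2 is spanned by 1, s_1, s_1^-1, which map to three of the 20
   words, whence injectivity. The words s_2^-1 s_1 s_2^-1 and s_2 s_1^-1 s_2
   differ by the unit factor bc up to words of the other shapes, so either one
   may complete the spanning set. *)

Require Import Defs.
From HB Require Import structures.
From mathcomp Require Import all_boot all_order all_algebra.
From mathcomp Require Import boolp classical_sets.

Set Implicit Arguments.
Unset Strict Implicit.
Unset Printing Implicit Defensive.

Import GRing.Theory.
Local Open Scope ring_scope.

(** * Computable Laurent polynomials and rewriting of words *)

Definition mono := (int * int * int)%type.
Definition lpoly := seq (mono * int).
(* [(e, b)] is s_1 (if [e = false]) or s_2 (if [e = true]), inverted when
   [b = false]. *)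
Definition letter := (bool * bool)%type.
Definition ncpoly := seq (seq letter * lpoly).
Definition rule := (seq letter * ncpoly)%type.

Definition mono_mul (m n : mono) : mono :=
  (intZmod.addz m.1.1 n.1.1, intZmod.addz m.1.2 n.1.2, intZmod.addz m.2 n.2).

Definition mono_inv (m : mono) : mono :=
  (intZmod.oppz m.1.1, intZmod.oppz m.1.2, intZmod.oppz m.2).

(** A monomial whose coefficient cancels is removed, because later tests recognise zero as the empty
    list. *)
Fixpoint lpoly_addm (m : mono) (z : int) (p : lpoly) : lpoly :=
  if p is (n, y) :: q then
    if m == n then
      let s := intZmod.addz z y in if s == 0 then q else (n, s) :: q
    else (n, y) :: lpoly_addm m z q
  else [:: (m, z)].

Definition lpoly_add (p q : lpoly) : lpoly :=
  foldr (fun t => lpoly_addm t.1 t.2) q p.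

Definition lpoly_mul (p q : lpoly) : lpoly :=
  foldr (fun t r => foldr (fun s => lpoly_addm (mono_mul t.1 s.1)
                                      (intRing.mulz t.2 s.2)) r q) [::] p.

Definition lmono (i j k z : int) : lpoly := [:: ((i, j, k), z)].
Definition lone : lpoly := lmono 0 0 0 1.
Definition lopp : lpoly := lmono 0 0 0 (- 1).

(* Inverts [m] and [- m] for a monomial [m]; a junk value otherwise, which is
   harmless in [solve_for]. *)
Definition linv (p : lpoly) : lpoly :=
  if p is [:: (m, z)] then [:: (mono_inv m, z)] else [::].

Fixpoint ncpoly_addw (w : seq letter) (l : lpoly) (p : ncpoly) : ncpoly :=
  if p is (v, k) :: q then
    if w == v then
      let s := lpoly_add l k in if s is [::] then q else (v, s) :: q
    else (v, k) :: ncpoly_addw w l q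
  else [:: (w, l)].

Definition ncpoly_add (p q : ncpoly) : ncpoly :=
  foldr (fun t => ncpoly_addw t.1 t.2) q p.

Definition ncpoly_scale (l : lpoly) (p : ncpoly) : ncpoly :=
  [seq (t.1, lpoly_mul l t.2) | t <- p].

Definition ncpoly_wrap (u : seq letter) (p : ncpoly) (v : seq letter) :
  ncpoly := [seq (u ++ t.1 ++ v, t.2) | t <- p].

Fixpoint ncpoly_coef (p : ncpoly) (w : seq letter) : lpoly :=
  if p is (v, l) :: q then if w == v then l else ncpoly_coef q w else [::].

Definition ncpoly_of (w : seq letter) : ncpoly := [:: (w, lone)].

(** If [r.1] does not occur in [w], then [infix_index] returns a position past the end of [w] and
    the comparison with [u ++ r.1 ++ v] fails. *)
Fixpoint rewrite_word (rs : seq rule) (w : seq letter) : ncpoly :=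
  if rs is r :: rs' then
    let i := infix_index r.1 w in
    let u := take i w in
    let v := drop (i + size r.1) w in
    if w == u ++ r.1 ++ v then ncpoly_wrap u r.2 v else rewrite_word rs' w
  else ncpoly_of w.

Definition rewrite_pass (rs : seq rule) (p : ncpoly) : ncpoly :=
  foldr (fun t => ncpoly_add (ncpoly_scale t.2 (rewrite_word rs t.1))) [::] p.

(* Eight passes suffice for the words met below; soundness does not depend on
   reaching a normal form. *)
Definition normalize (rs : seq rule) (p : ncpoly) : ncpoly :=
  iter 8 (rewrite_pass rs) p.

(** The default, [w] itself, keeps the value correct when no rule has left-hand side [w]. *)
Definition rhs_of (rs : seq rule) (w : seq letter) : ncpoly :=
  (head (w, ncpoly_of w) [seq r <- rs | r.1 == w]).2.

Definition relator (rs : seq rule) (u w v : seq letter) : ncpoly :=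
  ncpoly_addw (u ++ w ++ v) lone
    (ncpoly_scale lopp (ncpoly_wrap u (rhs_of rs w) v)).

(* The result holds in any algebra where [p] vanishes, whatever its coefficient
   at [w], because [w + l p = w] there for every scalar [l]; the choice of [l]
   only serves to make [w] cancel on the right. *)
Definition solve_for (w : seq letter) (p : ncpoly) : rule :=
  (w, ncpoly_addw w lone
        (ncpoly_scale (lpoly_mul lopp (linv (ncpoly_coef p w))) p)).

Definition complete_step (rs : seq rule)
    (s : (seq letter * seq letter * seq letter) * seq letter) : seq rule :=
  let: (u, w, v, lead) := s in
  rcons rs (solve_for lead (normalize rs (relator rs u w v))).

Definition complete := foldl complete_step.

(** * Evaluation in an algebra and soundness of rewriting *)

Section Evaluation.
Variables (K : comNzRingType) (mu : mono -> K).
Hypothesis mu1 : mu (0, 0, 0) = 1.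
Hypothesis muM : forall m n, mu (mono_mul m n) = mu m * mu n.

Definition lpoly_eval (p : lpoly) : K := \sum_(t <- p) mu t.1 *~ t.2.

Lemma lpoly_eval_addm m z p :
  lpoly_eval (lpoly_addm m z p) = mu m *~ z + lpoly_eval p.
Proof.
rewrite /lpoly_eval; elim: p => [|[n y] p IHp] /=.
  by rewrite big_seq1 big_nil addr0.
case: eqP => [<-|_]; last by rewrite !big_cons IHp addrCA.
rewrite [in RHS]big_cons addrA -mulrzDr -[(z + y)%R]/(intZmod.addz z y) /=.
by case: eqP => [->|_]; rewrite ?mulr0z ?add0r ?big_cons.
Qed.

Lemma lpoly_evalD p q :
  lpoly_eval (lpoly_add p q) = lpoly_eval p + lpoly_eval q.
Proof.
elim: p => [|t p IHp] /=; first by rewrite /lpoly_eval big_nil add0r.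
by rewrite lpoly_eval_addm IHp addrA [in RHS]/lpoly_eval big_cons.
Qed.

Lemma lpoly_evalM p q :
  lpoly_eval (lpoly_mul p q) = lpoly_eval p * lpoly_eval q.
Proof.
elim: p => [|t p IHp] /=; first by rewrite /lpoly_eval big_nil mul0r.
rewrite [lpoly_eval (t :: p)]/lpoly_eval big_cons mulrDl.
rewrite -[X in _ + X * _]/(lpoly_eval p).
rewrite -IHp; move: (lpoly_mul p q) => r {IHp}; elim: q => [|s q IHq] /=.
  by rewrite [lpoly_eval [::]]/lpoly_eval big_nil mulr0 add0r.
rewrite lpoly_eval_addm IHq [lpoly_eval (s :: q)]/lpoly_eval big_cons mulrDr.
by rewrite addrA muM -[intRing.mulz _ _]/(t.2 * s.2) mulrzA mulrzAr !mulrzAl.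
Qed.

Lemma lpoly_eval0 : lpoly_eval [::] = 0.
Proof. exact: big_nil. Qed.

Lemma lpoly_eval_mono i j k z : lpoly_eval (lmono i j k z) = mu (i, j, k) *~ z.
Proof. exact: big_seq1. Qed.

Lemma lpoly_eval1 : lpoly_eval lone = 1.
Proof. by rewrite lpoly_eval_mono mu1 mulr1z. Qed.

Lemma lpoly_evalN1 : lpoly_eval lopp = -1.
Proof. by rewrite lpoly_eval_mono mu1 mulrN1z. Qed.

Variables (A : algType K) (g : letter -> A).

Definition word_eval (w : seq letter) : A := \prod_(l <- w) g l.

Lemma word_eval_cat u v : word_eval (u ++ v) = word_eval u * word_eval v.
Proof. exact: big_cat. Qed.

Definition ncpoly_eval (p : ncpoly) : A :=
  \sum_(t <- p) lpoly_eval t.2 *: word_eval t.1.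

Lemma ncpoly_eval_of w : ncpoly_eval (ncpoly_of w) = word_eval w.
Proof. by rewrite /ncpoly_eval big_seq1 lpoly_eval1 scale1r. Qed.

Lemma ncpoly_eval_addw w l p :
  ncpoly_eval (ncpoly_addw w l p) = lpoly_eval l *: word_eval w + ncpoly_eval p.
Proof.
rewrite /ncpoly_eval; elim: p => [|[v k] p IHp] /=.
  by rewrite big_seq1 big_nil addr0.
case: eqP => [<-|_]; last by rewrite !big_cons IHp addrCA.
rewrite [in RHS]big_cons addrA -scalerDl -lpoly_evalD.
case: (lpoly_add l k) => [|t q]; rewrite ?big_cons //.
by rewrite lpoly_eval0 scale0r add0r.
Qed.

Lemma ncpoly_evalD p q :
  ncpoly_eval (ncpoly_add p q) = ncpoly_eval p + ncpoly_eval q.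
Proof.
elim: p => [|t p IHp] /=.
  by rewrite [ncpoly_eval [::]]/ncpoly_eval big_nil add0r.
by rewrite ncpoly_eval_addw IHp addrA [in RHS]/ncpoly_eval big_cons.
Qed.

Lemma ncpoly_evalZ l p :
  ncpoly_eval (ncpoly_scale l p) = lpoly_eval l *: ncpoly_eval p.
Proof.
rewrite /ncpoly_eval big_map scaler_sumr; apply: eq_bigr => t _ /=.
by rewrite lpoly_evalM scalerA.
Qed.

Lemma ncpoly_eval_wrap u p v :
  ncpoly_eval (ncpoly_wrap u p v) = word_eval u * ncpoly_eval p * word_eval v.
Proof.
rewrite /ncpoly_eval big_map mulr_sumr mulr_suml; apply: eq_bigr => t _ /=.
by rewrite !word_eval_cat -scalerAr -scalerAl mulrA.
Qed.

(** The letters take arbitrary values [g]; that [g (e, false)] inverts [g (e, true)] is expressed by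
    rules, like any other relation. *)
Definition sound (rs : seq rule) : Prop :=
  {in rs, forall r, word_eval r.1 = ncpoly_eval r.2}.

Lemma rewrite_word_sound rs w :
  sound rs -> ncpoly_eval (rewrite_word rs w) = word_eval w.
Proof.
elim: rs => [|r rs IHrs] /= rsP; first exact: ncpoly_eval_of.
case: eqP => [def_w|_]; last first.
  by apply: IHrs => s rs_s; apply: rsP; rewrite in_cons rs_s orbT.
rewrite ncpoly_eval_wrap -(rsP r) ?in_cons ?eqxx // -mulrA -!word_eval_cat.
by rewrite -def_w.
Qed.

Lemma rewrite_pass_sound rs p :
  sound rs -> ncpoly_eval (rewrite_pass rs p) = ncpoly_eval p.
Proof.
move=> rsP; elim: p => //= t p IHp.
rewrite ncpoly_evalD ncpoly_evalZ rewrite_word_sound // IHp.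
by rewrite [in RHS]/ncpoly_eval big_cons.
Qed.

Lemma normalize_sound rs p :
  sound rs -> ncpoly_eval (normalize rs p) = ncpoly_eval p.
Proof.
move=> rsP; rewrite /normalize; elim: 8%N => //= n.
by rewrite rewrite_pass_sound.
Qed.

Lemma rhs_of_sound rs w : sound rs -> ncpoly_eval (rhs_of rs w) = word_eval w.
Proof.
move=> rsP; rewrite /rhs_of.
have matchP r : r \in [seq r <- rs | r.1 == w] ->
    word_eval w = ncpoly_eval r.2.
  by rewrite mem_filter => /andP[/eqP <- /rsP].
case: [seq _ <- _ | _] matchP => [|r s] matchP /=; first exact: ncpoly_eval_of.
by apply/esym/matchP; rewrite in_cons eqxx.
Qed.

Lemma relator_sound rs u w v :
  sound rs -> ncpoly_eval (relator rs u w v) = 0.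
Proof.
move=> rsP; rewrite ncpoly_eval_addw ncpoly_evalZ ncpoly_eval_wrap.
rewrite rhs_of_sound // lpoly_eval1 lpoly_evalN1 scale1r scaleN1r.
by rewrite !word_eval_cat mulrA subrr.
Qed.

Lemma solve_for_sound w p : ncpoly_eval p = 0 ->
  word_eval (solve_for w p).1 = ncpoly_eval (solve_for w p).2.
Proof.
move=> p0; rewrite ncpoly_eval_addw ncpoly_evalZ p0 scaler0 addr0.
by rewrite lpoly_eval1 scale1r.
Qed.

(** Each added rule is solved from a relator that vanishes by the rules already present. *)
Lemma complete_sound rs steps : sound rs -> sound (complete rs steps).
Proof.
elim: steps rs => //= [[[[u w] v] lead] steps] IH rs rsP; apply: IH => r.
rewrite mem_rcons in_cons => /orP[/eqP ->|]; last exact: rsP.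
by apply: solve_for_sound; rewrite normalize_sound // relator_sound.
Qed.

End Evaluation.

(** * Matrices of Laurent polynomials *)

Definition lmatrix := seq (seq lpoly).

(** The default [[::]] is the zero polynomial, so missing entries read as zero and [[::]] also
    serves as the zero matrix. *)
Definition entry (M : lmatrix) (i j : nat) : lpoly := nth [::] (nth [::] M i) j.

Definition mk_lmatrix (n : nat) (f : nat -> nat -> lpoly) : lmatrix :=
  mkseq (fun i => mkseq (f i) n) n.

Definition lmatrix_add n (M N : lmatrix) : lmatrix :=
  mk_lmatrix n (fun i j => lpoly_add (entry M i j) (entry N i j)).

Definition lmatrix_scale n (l : lpoly) (M : lmatrix) : lmatrix :=
  mk_lmatrix n (fun i j => lpoly_mul l (entry M i j)).

Definition lmatrix_mul n (M N : lmatrix) : lmatrix :=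
  mk_lmatrix n (fun i j =>
    foldr (fun k => lpoly_add (lpoly_mul (entry M i k) (entry N k j))) [::]
      (iota 0 n)).

Definition lmatrix1 n : lmatrix :=
  mk_lmatrix n (fun i j => if i == j then lone else [::]).

Definition lmatrix_word n (G : letter -> lmatrix) (w : seq letter) : lmatrix :=
  foldr (fun l => lmatrix_mul n (G l)) (lmatrix1 n) w.

Definition lmatrix_poly n (G : letter -> lmatrix) (p : ncpoly) : lmatrix :=
  foldr (fun t => lmatrix_add n (lmatrix_scale n t.2 (lmatrix_word n G t.1)))
    [::] p.

Definition rule_holds n (G : letter -> lmatrix) (r : rule) : bool :=
  let M := lmatrix_poly n G
             (ncpoly_addw r.1 lone (ncpoly_scale lopp r.2)) in
  all (fun i => all (fun j => nilp (entry M i j)) (iota 0 n)) (iota 0 n).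

(** Column 0 is the image of the first basis vector, that of the empty word. *)
Definition column_is n (G : letter -> lmatrix) (w : seq letter) (k : nat) :=
  let M := lmatrix_word n G w in
  all (fun i => entry M i 0 == if i == k then lone else [::]) (iota 0 n).

Section MatrixEvaluation.
Variables (K : comNzRingType) (mu : mono -> K).
Hypothesis mu1 : mu (0, 0, 0) = 1.
Hypothesis muM : forall m n, mu (mono_mul m n) = mu m * mu n.
Variable n : nat.

Definition lmatrix_eval (M : lmatrix) : 'M[K]_n.+1 :=
  \matrix_(i, j) lpoly_eval mu (entry M i j).

Lemma lmatrix_eval_mk f :
  lmatrix_eval (mk_lmatrix n.+1 f) = \matrix_(i, j) lpoly_eval mu (f i j).
Proof. by apply/matrixP => i j; rewrite !mxE /entry !nth_mkseq. Qed.

Lemma lmatrix_evalD M N : lmatrix_eval (lmatrix_add n.+1 M N) =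
  lmatrix_eval M + lmatrix_eval N.
Proof.
by rewrite lmatrix_eval_mk; apply/matrixP => i j; rewrite !mxE lpoly_evalD.
Qed.

Lemma lmatrix_evalZ l M : lmatrix_eval (lmatrix_scale n.+1 l M) =
  lpoly_eval mu l *: lmatrix_eval M.
Proof.
by rewrite lmatrix_eval_mk; apply/matrixP => i j; rewrite !mxE lpoly_evalM.
Qed.

Lemma lmatrix_evalM M N : lmatrix_eval (lmatrix_mul n.+1 M N) =
  lmatrix_eval M * lmatrix_eval N.
Proof.
rewrite lmatrix_eval_mk; apply/matrixP => i j; rewrite !mxE.
under [RHS]eq_bigr do rewrite !mxE.
(* The sum over ordinals becomes a sum over [iota], the list folded by [lmatrix_mul]. *)
rewrite -(big_mkord xpredT (fun k => lpoly_eval mu (entry M i k) *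
                                     lpoly_eval mu (entry N k j))).
rewrite /index_iota subn0; elim: (iota 0 n.+1) => [|k s IHs].
  by rewrite big_nil /= lpoly_eval0.
by rewrite big_cons /= lpoly_evalD lpoly_evalM // IHs.
Qed.

Lemma lmatrix_eval1 : lmatrix_eval (lmatrix1 n.+1) = 1.
Proof.
rewrite lmatrix_eval_mk; apply/matrixP => i j.
rewrite !mxE -(inj_eq val_inj) /=.
by case: eqP => _; rewrite ?lpoly_eval1 ?lpoly_eval0.
Qed.

Variable G : letter -> lmatrix.
Let g l := lmatrix_eval (G l).

Lemma lmatrix_eval_word w :
  lmatrix_eval (lmatrix_word n.+1 G w) = word_eval g w.
Proof.
elim: w => [|l w IHw]; first by rewrite lmatrix_eval1 /word_eval big_nil.
by rewrite /= lmatrix_evalM IHw [in RHS]/word_eval big_cons.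
Qed.

Lemma lmatrix_eval_poly p :
  lmatrix_eval (lmatrix_poly n.+1 G p) = ncpoly_eval mu g p.
Proof.
elim: p => [|t p IHp].
  rewrite /ncpoly_eval big_nil; apply/matrixP => i j.
  by rewrite !mxE /entry !nth_nil lpoly_eval0.
rewrite /= lmatrix_evalD lmatrix_evalZ lmatrix_eval_word IHp.
by rewrite [in RHS]/ncpoly_eval big_cons.
Qed.

Lemma rule_holds_sound r :
  rule_holds n.+1 G r -> word_eval g r.1 = ncpoly_eval mu g r.2.
Proof.
rewrite /rule_holds; set p := ncpoly_addw _ _ _ => /allP r0.
apply/eqP; rewrite -subr_eq0.
have <- : ncpoly_eval mu g p = word_eval g r.1 - ncpoly_eval mu g r.2.
  rewrite ncpoly_eval_addw ncpoly_evalZ // lpoly_eval1 // lpoly_evalN1 //.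
  by rewrite scale1r scaleN1r.
rewrite -lmatrix_eval_poly; apply/eqP/matrixP => i j; rewrite !mxE.
have := r0 i; rewrite mem_iota ltn_ord => /(_ isT) /allP /(_ j).
by rewrite mem_iota ltn_ord => /(_ isT) /nilP ->; rewrite lpoly_eval0.
Qed.

Lemma column_is_sound w (k i : 'I_n.+1) :
  column_is n.+1 G w k -> word_eval g w i 0 = (i == k)%:R.
Proof.
move/allP/(_ i); rewrite mem_iota ltn_ord => /(_ isT) /eqP ik.
rewrite -lmatrix_eval_word mxE ik (inj_eq val_inj).
by case: eqP; rewrite ?lpoly_eval1 ?lpoly_eval0.
Qed.

End MatrixEvaluation.

(** * Presentations of Q_2 and Q_3 by rewriting rules *)

Local Notation g1 := (false, true).
Local Notation g1' := (false, false).
Local Notation g2 := (true, true).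
Local Notation g2' := (true, false).

(** The cubic relation multiplied by s^-1 and solved for s^2: s^2 = e_1 s - e_2 + e_3 s^-1, with e_i
    the elementary symmetric functions of a, b, c. *)
Definition cubic_rhs (l : letter) : ncpoly :=
  [:: ([:: l], lmono 1 0 0 1 ++ lmono 0 1 0 1 ++ lmono 0 0 1 1);
      ([::], lmono 1 1 0 (-1) ++ lmono 1 0 1 (-1) ++ lmono 0 1 1 (-1));
      ([:: (l.1, ~~ l.2)], lmono 1 1 1 1)].

Definition Q2_rules : seq rule :=
  [:: ([:: g1; g1'], ncpoly_of [::]); ([:: g1'; g1], ncpoly_of [::]);
      ([:: g1; g1], cubic_rhs g1)].

(** The rule for s_2^2 is not a defining relation; it holds because s_2 is conjugate to s_1. The
    last rule is the long defining relation. *)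
Definition Q3_rules : seq rule :=
  [:: ([:: g1; g1'], ncpoly_of [::]); ([:: g1'; g1], ncpoly_of [::]);
      ([:: g2; g2'], ncpoly_of [::]); ([:: g2'; g2], ncpoly_of [::]);
      ([:: g1; g1], cubic_rhs g1); ([:: g2; g2], cubic_rhs g2);
      ([:: g2; g1; g2], ncpoly_of [:: g1; g2; g1]);
      ([:: g1'; g2; g1],
       [:: ([:: g1; g2; g1'], lone);
           ([:: g1; g2], lmono (-1) 0 0 (-1));
           ([:: g1; g2'], lmono 1 0 0 1);
           ([:: g1'; g2], lmono 1 0 0 1);
           ([:: g1'; g2'], lmono 3 0 0 (-1));
           ([:: g2; g1], lmono (-1) 0 0 1);
           ([:: g2; g1'], lmono 1 0 0 (-1));
           ([:: g2'; g1], lmono 1 0 0 (-1));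
           ([:: g2'; g1'], lmono 3 0 0 1);
           ([:: g1'; g2'; g1], lmono 2 0 0 1);
           ([:: g1; g2'; g1'], lmono 2 0 0 (-1))])].

(* A step [(u, w, v, lead)] compares the two reductions of [u w v] that start
   with the rule for [w], resp. with the first applicable rule, and solves for
   [lead]. *)
Definition Q3_completion : seq rule := complete Q3_rules
  [:: ([::], [:: g1; g1], [:: g1'], [:: g1'; g1']);
      ([::], [:: g2; g2], [:: g2'], [:: g2'; g2']);
      ([:: g1'], [:: g2; g1; g2], [:: g2'], [:: g2; g1; g2']);
      ([:: g1'; g2'], [:: g2; g1; g2], [:: g1'; g2'], [:: g2; g1'; g2']);
      ([:: g2'], [:: g2; g1; g2], [:: g1'], [:: g2'; g1; g2]);
      ([:: g2'; g1'], [:: g2; g1; g2], [:: g2'; g1'], [:: g2'; g1'; g2]);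
      ([:: g1'; g2'; g1'], [:: g2; g1; g2], [:: g2'; g1'; g2'],
       [:: g2'; g1'; g2']);
      ([:: g1], [:: g1'; g2; g1], [::], [:: g1; g2; g1]);
      ([:: g2], [:: g2; g1; g2'], [::], [:: g2; g1'; g2]);
      ([:: g2'], [:: g2'; g1'; g2], [::], [:: g2'; g1; g2'; g1']);
      ([::], [:: g2; g1'; g2'], [:: g2'], [:: g1'; g2'; g1; g2']);
      ([::], [:: g2'; g1'; g2], [:: g1'; g2'], [:: g1; g2'; g1; g2']);
      ([::], [:: g2'; g1; g2], [:: g1; g2'], [:: g2'; g1; g2'; g1])].

Definition Q2_basis : seq (seq letter) := [:: [::]; [:: g1]; [:: g1']].

Definition sandwiches (l : letter) : seq (seq letter) :=
  [seq u ++ l :: v | u <- Q2_basis, v <- Q2_basis].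

(** There are 3 + 7 + 9 + 1 = 20 words: the two words left out are left-hand sides of rules of
    [Q3_completion]. The order matters: the empty word comes first and [Q2_basis] is an initial
    segment. *)
Definition Q3_basis : seq (seq letter) :=
  Q2_basis
  ++ [seq w <- sandwiches g2 | w \notin [:: [:: g1; g2; g1]; [:: g1'; g2; g1]]]
  ++ sandwiches g2' ++ [:: [:: g2'; g1; g2']].

Definition letters : seq letter := [:: g1; g1'; g2; g2'].

Definition laurent_mono (m : mono) : laurent := laurentX m.1.1 m.1.2 m.2.

Lemma laurent_mono1 : laurent_mono (0, 0, 0) = 1.
Proof. exact: (grpU1 int laurent_mon). Qed.

Lemma laurent_monoM m n :
  laurent_mono (mono_mul m n) = laurent_mono m * laurent_mono n.
Proof. exact: esym (laurentXM _ _ _ _ _ _). Qed.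

(** * Words in the Artin generators and their classes in [Q n] *)

Section BraidWords.
Variables (n : nat) (i j : 'I_n.-1).

Definition braid_letter (l : letter) : braid n :=
  let s := artin (if l.1 then j else i) in if l.2 then s else s^-1%g.

Definition braid_word (w : seq letter) : braid n :=
  \big[*%g/1%g]_(l <- w) braid_letter l.

Lemma braid_word_hom (A : algType laurent) (f : braid n -> A) :
  f 1%g = 1 -> {morph f : g h / (g * h)%g >-> g * h} ->
  forall w, f (braid_word w) = word_eval (f \o braid_letter) w.
Proof. by move=> f1 fM w; apply: big_morph. Qed.

Definition Qletter (l : letter) : Q n := Qbraid (braid_letter l).

Lemma Qbraid_word w : Qbraid (braid_word w) = word_eval Qletter w.
Proof. exact: (braid_word_hom (@Qbraid1 n) (@QbraidM n)). Qed.

Lemma Qletter_mulV e b : Qletter (e, b) * Qletter (e, ~~ b) = 1.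
Proof. by rewrite -QbraidM; case: b; rewrite ?mulgV ?mulVg Qbraid1. Qed.

End BraidWords.

(** Braid group elements span [Q n], and each is reached from 1 by left multiplications by
    generators and their inverses. Passing [k] twice to [Qletter] makes [(false, b)] denote the
    generator of index [k] or its inverse. *)
Lemma Q_ind n (P : Q n -> Prop) :
  (forall (c : laurent) x y, P x -> P y -> P (c *: x + y)) -> P 0 -> P 1 ->
  (forall k b x, P x -> P (Qletter k k (false, b) * x)) -> forall x, P x.
Proof.
move=> Plin P0 P1 PM x; rewrite -[x]QpiK.
elim/grpalg_ind: (repr x) => [|u v Pu Pv|c g]; first by rewrite [Qpi _]linear0.
  have -> : Qpi (u + v) = 1 *: Qpi u + Qpi v by rewrite scale1r; apply: linearD.
  exact: Plin.
have -> : grpmono c g = c *: braidU g.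
  by rewrite /braidU /grpU grpalg_scaleU mulr1.
have -> : Qpi (c *: braidU g) = c *: Qbraid g + 0.
  by rewrite addr0; apply: linearZ.
apply: Plin => //; rewrite -[g]pres_classK.
elim: (repr g) => [|[k b] w IHw]; first by rewrite pres_class1 Qbraid1.
rewrite -cat1s pres_classM QbraidM.
have -> : Qbraid (pres_class (@braid_rel n) [:: (k, b)]) =
    Qletter k k (false, b).
  by case: b; rewrite // -pres_genV.
exact: PM.
Qed.

Definition e1 : laurent := La + Lb + Lc.
Definition e2 : laurent := La * Lb + La * Lc + Lb * Lc.
Definition e3 : laurent := La * Lb * Lc.

Lemma cubic_rhs_eval (A : algType laurent) (g : letter -> A) l :
  ncpoly_eval laurent_mono g (cubic_rhs l) =
  e1 *: g l - e2%:A + e3 *: g (l.1, ~~ l.2).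
Proof.
rewrite /ncpoly_eval !big_cons big_nil /= /word_eval !big_seq1 big_nil addr0.
rewrite !lpoly_eval_mono /lpoly_eval !big_cons !big_nil /= !addr0.
rewrite !mulrN1z !mulr1z.
rewrite -!opprD scaleNr addrA /laurent_mono /=.
by rewrite /e1 /e2 /e3 /La /Lb /Lc !laurentXM !addrA.
Qed.

Lemma unit_e3 : e3 \is a GRing.unit.
Proof. by rewrite !unitrM !laurentX_unit. Qed.

(** Solves for s_1^2 the formula of [Qbraid_artinV] for s_1^-1, using that abc is a unit. *)
Lemma Qsquare n (i j : 'I_n.-1) : i = 0%N :> nat ->
  Qletter i j g1 * Qletter i j g1 =
  e1 *: Qletter i j g1 - e2%:A + e3 *: Qletter i j g1'.
Proof.
move=> i0; have := Qbraid_artinV i0.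
rewrite -[Qbraid (artin i)]/(Qletter i j g1).
rewrite -[Qbraid _^-1%g]/(Qletter i j g1') => ->.
rewrite scalerA mulrV ?unit_e3 // scale1r.
by rewrite scaleNr [RHS]addrACA addNr addr0 addrC subrK.
Qed.

Lemma Q2_rules_sound (j : 'I_1) :
  sound laurent_mono (@Qletter 2 ord0 j) Q2_rules.
Proof.
move=> r; rewrite !inE => /or3P[] /eqP -> /=; last first.
  by rewrite cubic_rhs_eval -Qsquare // /word_eval !big_cons big_nil mulr1.
all: rewrite (ncpoly_eval_of laurent_mono1) /word_eval !big_cons big_nil mulr1.
all: exact: Qletter_mulV.
Qed.

Definition braid3_letter : letter -> braid 3 :=
  @braid_letter 3 (@ord0 1) (@ord_max 1).

Definition braid3_word : seq letter -> braid 3 :=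
  @braid_word 3 (@ord0 1) (@ord_max 1).

Definition Q3letter : letter -> Q 3 := @Qletter 3 (@ord0 1) (@ord_max 1).

Lemma Q3letter_braid :
  Q3letter g1 * (Q3letter g2 * Q3letter g1) =
  Q3letter g2 * (Q3letter g1 * Q3letter g2).
Proof. rewrite -!QbraidM; congr (Qbraid _); exact: (@artin_near 3). Qed.

(** The relation imposed on s_1 passes to s_2 by conjugation: for u = s_1 s_2 the braid relation
    reads u s_1 = s_2 u. *)
Lemma Q3letter_square2 : Q3letter g2 * Q3letter g2 =
  e1 *: Q3letter g2 - e2%:A + e3 *: Q3letter g2'.
Proof.
pose t1 := @artin 3 (@ord0 1); pose t2 := @artin 3 (@ord_max 1).
have [u conjt] : exists u, t2 = (u * t1 * u^-1)%g.
  exists (t1 * t2)%g; apply: (mulIg (t1 * t2)%g); rewrite mulgVK -!mulgA.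
  exact/esym/(@artin_near 3).
have conj l : Q3letter (true, l) =
    Qbraid u * Q3letter (false, l) * Qbraid u^-1%g.
  rewrite -!QbraidM /Q3letter /Qletter /braid_letter /= -/t1 -/t2.
  by case: l; rewrite conjt // !invgM invgK mulgA.
have uV : Qbraid u^-1%g * Qbraid u = 1 by rewrite -QbraidM mulVg Qbraid1.
have uV' : Qbraid u * Qbraid u^-1%g = 1 by rewrite -QbraidM mulgV Qbraid1.
rewrite !conj -!mulrA (mulrA (Qbraid u^-1%g)) uV mul1r (mulrA (Q3letter g1)).
rewrite (@Qsquare 3 (@ord0 1) (@ord_max 1)) // mulrDl mulrBl mulrDr mulrBr.
by rewrite -!scalerAl -!scalerAr mul1r uV'.
Qed.

Section Q3Morph.
Variables (A : algType laurent) (f : {lrmorphism braid_alg 3 -> A}).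

Definition morph_letter (l : letter) : A :=
  f (braidU (braid3_letter l)).

Lemma morph_braid_word w :
  f (braidU (braid3_word w)) =
  word_eval morph_letter w.
Proof.
apply: (@braid_word_hom 3 _ _ A (f \o @braidU 3)) => [|g h] /=.
  exact: rmorph1.
by rewrite /braidU grpUM rmorphM.
Qed.

(** Links the long relation in the group algebra to its coded rule, under any algebra morphism. Read
    forwards for [Qpi], it gives the rule in [Q 3]; read backwards for [rep], it shows that the
    matrices respect the relation. *)
Lemma Q3relation_eval :
  let t1 := @artin 3 (@ord0 1) in let t2 := @artin 3 (@ord_max 1) in
  f (braidU (t1^-1 * t2 * t1)%g) = f (Qrhs t1 t2) <->
  word_eval morph_letter [:: g1'; g2; g1] =
  ncpoly_eval laurent_mono morph_letter
    (rhs_of Q3_rules [:: g1'; g2; g1]).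
Proof.
move=> t1 t2.
have lE (i j k : int) z :
    lpoly_eval laurent_mono (lmono i j k z) = laurentX i j k *~ z.
  exact: lpoly_eval_mono.
have w3 a b c :
    f (braidU (braid3_letter a * braid3_letter b * braid3_letter c)%g) =
    word_eval morph_letter [:: a; b; c].
  by rewrite -morph_braid_word /braid3_word /braid_word !big_cons big_nil
             mulg1 mulgA.
have w2 a b : f (braidU (braid3_letter a * braid3_letter b)%g) =
    word_eval morph_letter [:: a; b].
  by rewrite -morph_braid_word /braid3_word /braid_word !big_cons big_nil mulg1.
have -> : f (Qrhs t1 t2) = ncpoly_eval laurent_mono morph_letter
    (rhs_of Q3_rules [:: g1'; g2; g1]).
  rewrite Qrhs_morph /ncpoly_eval !big_cons big_nil.
  rewrite (w3 g1 g2 g1') (w2 g1 g2) (w2 g1 g2') (w2 g1' g2) (w2 g1' g2').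
  rewrite (w2 g2 g1) (w2 g2 g1') (w2 g2' g1) (w2 g2' g1') (w3 g1' g2' g1).
  rewrite (w3 g1 g2' g1').
  rewrite /fst /snd (lpoly_eval1 laurent_mono1) !lE scale1r addr0.
  have -> : La^-1 = laurentX (-1) 0 0 by rewrite /La laurentXV oppr0.
  have -> : La ^+ 2 = laurentX 2 0 0 by rewrite expr2 laurentXM.
  have -> : La ^+ 3 = laurentX 3 0 0 by rewrite exprS expr2 !laurentXM.
  by rewrite !mulrN1z !mulr1z !scaleNr !addrA.
by rewrite (w3 g1' g2 g1).
Qed.

End Q3Morph.

Lemma Q3_rules_sound : sound laurent_mono Q3letter Q3_rules.
Proof.
have ofE w := ncpoly_eval_of laurent_mono1 Q3letter w.
have squareE l : Q3letter l * Q3letter l =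
    e1 *: Q3letter l - e2%:A + e3 *: Q3letter (l.1, ~~ l.2) ->
    word_eval Q3letter [:: l; l] =
    ncpoly_eval laurent_mono Q3letter (cubic_rhs l).
  by move=> sqr; rewrite cubic_rhs_eval -sqr /word_eval !big_cons big_nil mulr1.
have invE e b : word_eval Q3letter [:: (e, b); (e, ~~ b)] =
    ncpoly_eval laurent_mono Q3letter (ncpoly_of [::]).
  by rewrite ofE /word_eval !big_cons big_nil mulr1; apply: Qletter_mulV.
move=> r; rewrite !in_cons in_nil orbF.
case/or4P=> [|||/or4P[||/eqP ->|/orP[] /eqP ->]].
- by move/eqP ->; apply: invE.
- by move/eqP ->; apply: invE.
- by move/eqP ->; apply: invE.
- by move/eqP ->; apply: invE.
- by move/eqP ->; apply/squareE/Qsquare.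
- exact/squareE/Q3letter_square2.
- rewrite ofE /word_eval !big_cons !big_nil !mulr1; exact: esym Q3letter_braid.
apply/(Q3relation_eval (@Qpi 3)).
have := @Qpi_eq0 3 _ (@QrelBraid 3 (@ord0 1) (@ord_max 1) erefl erefl).
by rewrite linearB => /eqP; rewrite subr_eq0 => /eqP.
Qed.

(** * Spanning words *)

Section Span.
Variables (K : comNzRingType) (mu : mono -> K).
Hypothesis mu1 : mu (0, 0, 0) = 1.
Hypothesis muM : forall m n, mu (mono_mul m n) = mu m * mu n.
Variables (A : algType K) (g : letter -> A).

Definition word_span (B : seq (seq letter)) (v : A) : Prop :=
  exists c : 'I_(size B) -> K, v = \sum_i c i *: word_eval g (nth [::] B i).

Lemma word_span0 B : word_span B 0.
Proof. by exists (fun=> 0); rewrite big1 // => i _; rewrite scale0r. Qed.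

Lemma word_span_lin B c u v :
  word_span B u -> word_span B v -> word_span B (c *: u + v).
Proof.
move=> [a ->] [b ->]; exists (fun i => c * a i + b i).
rewrite scaler_sumr -big_split; apply: eq_bigr => i _ /=.
by rewrite scalerDl scalerA.
Qed.

Lemma word_span_mem B w : w \in B -> word_span B (word_eval g w).
Proof.
move=> Bw; have wlt : (index w B < size B)%N by rewrite index_mem.
exists (fun i => (i == Ordinal wlt)%:R); rewrite (bigD1 (Ordinal wlt)) //= eqxx.
rewrite scale1r nth_index // big1 ?addr0 // => i /negPf ->.
by rewrite scale0r.
Qed.

Lemma word_span_ncpoly B p :
  all (fun t => t.1 \in B) p -> word_span B (ncpoly_eval mu g p).
Proof.
rewrite /ncpoly_eval; elim: p => [|t p IHp] /=.
  by rewrite big_nil => _; apply: word_span0.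
move=> /andP[Bt Bp]; rewrite big_cons; apply: word_span_lin; last exact: IHp.
exact: word_span_mem.
Qed.

Definition stable (rs : seq rule) (B : seq (seq letter)) (l : letter) : bool :=
  all (fun w => all (fun t => t.1 \in B) (normalize rs (ncpoly_of (l :: w)))) B.

(** By linearity it is enough to treat [l :: w] with [w] in [B]; this has the value of its normal
    form, whose words all lie in [B]. *)
Lemma word_span_mull rs B l v : sound mu g rs -> stable rs B l ->
  word_span B v -> word_span B (g l * v).
Proof.
move=> rsP /allP Bl [c ->]; rewrite mulr_sumr.
elim/big_ind: _ => [|x y Bx By|i _]; first exact: word_span0.
  by rewrite -[x]scale1r; apply: word_span_lin.
rewrite -scalerAr -[_ *: _]addr0; apply: word_span_lin; last exact: word_span0.
set w := nth _ _ _; have -> : g l * word_eval g w = word_eval g (l :: w).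
  by rewrite /word_eval big_cons.
rewrite -(ncpoly_eval_of mu1) -(normalize_sound mu1 muM _ rsP).
by apply/word_span_ncpoly/Bl/mem_nth.
Qed.

End Span.

(** The computation behind spanning: all 80 products of a letter and a basis word normalise to
    combinations of basis words. *)
Lemma Q3_stable : all (stable Q3_completion Q3_basis) letters.
Proof. by vm_compute. Qed.

Lemma Q3_span v : word_span Q3letter Q3_basis v.
Proof.
have cP : sound laurent_mono Q3letter Q3_completion.
  exact/(complete_sound laurent_mono1 laurent_monoM)/Q3_rules_sound.
move: v; apply: Q_ind => [c x y||| k b x].
- exact: word_span_lin.
- exact: word_span0.
- have -> : 1 = word_eval Q3letter [::] by rewrite /word_eval big_nil.
  exact: word_span_mem.
(* The index [k] is 0 or 1, so [k != 0] tells s_2 from s_1 in the coding of letters. *)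
have -> : Qletter k k (false, b) = Q3letter (k != 0, b).
  case: k => [[|[|//]] kP]; rewrite /Q3letter /Qletter /braid_letter /=.
    by rewrite (_ : Ordinal kP = @ord0 1) //; apply: val_inj.
  by rewrite (_ : Ordinal kP = @ord_max 1) //; apply: val_inj.
apply: (word_span_mull laurent_mono1 laurent_monoM cP).
by apply: (allP Q3_stable); case: (k != 0); case: b.
Qed.

(** The overlap s_1 s_1 s_1^-1 yields the missing rule, for s_1^-2. *)
Definition Q2_completion : seq rule :=
  complete Q2_rules [:: ([::], [:: g1; g1], [:: g1'], [:: g1'; g1'])].

Definition Q2letter : letter -> Q 2 := @Qletter 2 (@ord0 0) (@ord0 0).

Lemma Q2_stable : all (stable Q2_completion Q2_basis) [:: g1; g1'].
Proof. by vm_compute. Qed.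

Lemma Q2_span v : word_span Q2letter Q2_basis v.
Proof.
have cP : sound laurent_mono Q2letter Q2_completion.
  exact/(complete_sound laurent_mono1 laurent_monoM)/Q2_rules_sound.
move: v; apply: Q_ind => [c x y||| k b x].
- exact: word_span_lin.
- exact: word_span0.
- have -> : 1 = word_eval Q2letter [::] by rewrite /word_eval big_nil.
  exact: word_span_mem.
have -> : k = @ord0 0 by apply/val_inj; case: k => [[]].
apply: (word_span_mull laurent_mono1 laurent_monoM cP).
by apply: (allP Q2_stable); case: b.
Qed.

(** * The representation on the free module of rank 20 *)

(** Left multiplication by [l] in the basis words: column [j] holds the coordinates of the product
    of [l] with the [j]-th word. *)
Definition action_matrix (l : letter) : lmatrix :=
  let columns :=
    [seq normalize Q3_completion (ncpoly_of (l :: w)) | w <- Q3_basis] in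
  mk_lmatrix 20
    (fun i j => ncpoly_coef (nth [::] columns j) (nth [::] Q3_basis i)).

(** Evaluated once, so that the checks below start from explicit matrices. *)
Definition action_matrix1 := Eval vm_compute in action_matrix g1.
Definition action_matrix1' := Eval vm_compute in action_matrix g1'.
Definition action_matrix2 := Eval vm_compute in action_matrix g2.
Definition action_matrix2' := Eval vm_compute in action_matrix g2'.

Definition action (l : letter) : lmatrix :=
  match l with
  | g1 => action_matrix1 | g1' => action_matrix1'
  | g2 => action_matrix2 | g2' => action_matrix2'
  end.

(** This makes the four matrices a representation of [Q 3]: the relations are verified on them by
    matrix arithmetic. *)
Lemma action_rules : all (rule_holds 20 action) Q3_rules.
Proof. by vm_compute. Qed.

Lemma action_unit :
  all (fun k => column_is 20 action (nth [::] Q3_basis k) k) (iota 0 20).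
Proof. by vm_compute. Qed.

Definition rep_letter (l : letter) : 'M[laurent]_20 :=
  lmatrix_eval laurent_mono 19 (action l).

Lemma rep_rules_sound : sound laurent_mono rep_letter Q3_rules.
Proof.
move=> r /(allP action_rules).
exact: (rule_holds_sound laurent_mono1 laurent_monoM).
Qed.

Lemma rep_letter_mulV e b : rep_letter (e, b) * rep_letter (e, ~~ b) = 1.
Proof.
have : ([:: (e, b); (e, ~~ b)], ncpoly_of [::]) \in Q3_rules.
  by case: e; case: b.
move/rep_rules_sound; rewrite (ncpoly_eval_of laurent_mono1) /word_eval.
by rewrite !big_cons big_nil mulr1.
Qed.

Definition rep_gen (l : 'I_2 * bool) : 'M[laurent]_20 :=
  rep_letter (l.1 != 0, l.2).

Lemma rep_gen_rel u v : @braid_rel 3 u v ->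
  \prod_(l <- u) rep_gen l = \prod_(l <- v) rep_gen l.
Proof.
case=> [[i ip] [j jp]|[i ip] [j jp]] /=.
  (* Far commutation would need two indices at distance at least 2 in ['I_2]. *)
  by case: j jp => [|[|//]].
move=> ij; case: j ij jp => [|[|//]] // [i0]; rewrite {i}i0 in ip * => jp.
have := @rep_rules_sound ([:: g2; g1; g2], ncpoly_of [:: g1; g2; g1]) isT.
rewrite (ncpoly_eval_of laurent_mono1) /word_eval /rep_gen.
by rewrite !big_cons !big_nil => /esym.
Qed.

Lemma rep_gen_inv k b : rep_gen (k, b) * rep_gen (k, ~~ b) = 1.
Proof. exact: rep_letter_mulV. Qed.

Definition rep_braid : braid 3 -> 'M[laurent]_20 := pres_lift *%R rep_gen.

Lemma rep_braid1 : rep_braid 1%g = 1.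
Proof. exact: (pres_lift1 rep_gen_rel rep_gen_inv). Qed.

Lemma rep_braidM g h : rep_braid (g * h)%g = rep_braid g * rep_braid h.
Proof. exact: (pres_liftM rep_gen_rel rep_gen_inv). Qed.

Definition rep : braid_alg 3 -> 'M[laurent]_20 := grpalg_lift rep_braid.

HB.instance Definition _ := GRing.isLinear.Build laurent (braid_alg 3)
  'M[laurent]_20 *:%R rep (grpalg_lift_linear rep_braid).
HB.instance Definition _ := GRing.isMonoidMorphism.Build (braid_alg 3)
  'M[laurent]_20 rep (grpalg_lift_monoid_morphism rep_braid1 rep_braidM).

Lemma rep_morph_letter : morph_letter rep =1 rep_letter.
Proof.
case=> e b; rewrite /morph_letter -[LHS]/(rep (grpU _)) /rep grpalg_liftU.
rewrite /rep_braid /braid_letter.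
by case: e b => [] []; [apply: (pres_lift_gen rep_gen_rel rep_gen_inv)
  |apply: (pres_lift_genV rep_gen_rel rep_gen_inv)
  |apply: (pres_lift_gen rep_gen_rel rep_gen_inv)
  |apply: (pres_lift_genV rep_gen_rel rep_gen_inv)].
Qed.

Lemma eq_word_eval (K : comNzRingType) (A : algType K) (g h : letter -> A) :
  g =1 h -> word_eval g =1 word_eval h.
Proof. by move=> gh w; apply: eq_bigr => l _; apply: gh. Qed.

(** The product expands to (s^2 - e_1 s + e_2) s - e_3; by hypothesis the bracket is e_3 t, and t s
    = 1. *)
Lemma cubic_eq0 (A : algType laurent) (s t : A) :
  s * s = e1 *: s - e2%:A + e3 *: t -> t * s = 1 ->
  (s - La%:A) * (s - Lb%:A) * (s - Lc%:A) = 0.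
Proof.
move=> sqr ts.
have -> : (s - La%:A) * (s - Lb%:A) * (s - Lc%:A) =
    (s * s + (- e1) *: s + e2%:A) * s - e3%:A.
  rewrite /e1 /e2 /e3.
  rewrite !(mulrBl, mulrBr, mulrDl, mulrDr, =^~ scalerAl, =^~ scalerAr).
  rewrite !(mulr1, mul1r, scalerA, scalerDl, scaleNr).
  rewrite !opprD !opprK !addrA.
  (* Both sides consist of the same eight terms in different orders. *)
  by rewrite [RHS](ACl (1*3*2*5*4*7*6*8)%AC).
rewrite sqr scaleNr.
rewrite [_ + e3 *: t - _]addrAC [_ - _ - e1 *: s]addrAC subrr sub0r.
rewrite [X in X * s]addrC addrA subrr add0r.
by rewrite -scalerAl ts subrr.
Qed.

Lemma rep_Qrel u : Qrel u -> rep u = 0.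
Proof.
have wordE w : word_eval (morph_letter rep) w = word_eval rep_letter w.
  exact/eq_word_eval/rep_morph_letter.
case=> {u} [i i0|i j i0 j1].
  have -> : i = @ord0 1 by apply: val_inj.
  rewrite -[LHS]/((rep : {lrmorphism _ -> _}) _) cubic_morph.
  rewrite -[X in (X - La%:A) * (X - Lb%:A) * (X - Lc%:A)]/(morph_letter rep g1).
  rewrite rep_morph_letter.
  apply: (@cubic_eq0 _ _ (rep_letter g1')); last exact: rep_letter_mulV.
  have := @rep_rules_sound ([:: g1; g1], cubic_rhs g1) isT.
  rewrite cubic_rhs_eval => <-.
  by rewrite /word_eval !big_cons big_nil mulr1.
have -> : i = @ord0 1 by apply: val_inj.
have -> : j = @ord_max 1 by apply: val_inj.
apply/eqP; rewrite [rep _]linearB subr_eq0; apply/eqP.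
apply/(Q3relation_eval (rep : {lrmorphism _ -> _})).
pose r := ([:: g1'; g2; g1], rhs_of Q3_rules [:: g1'; g2; g1]).
rewrite wordE (@rep_rules_sound r) //.
by apply: eq_bigr => t _; rewrite wordE.
Qed.

(** The combination lifts to the group algebra, where it lies in the ideal and is killed by [rep].
    By [action_unit], entry (k, 0) of the resulting zero matrix is [c k]. *)
Lemma Q3_free (c : 'I_20 -> laurent) :
  \sum_i c i *: word_eval Q3letter (nth [::] Q3_basis i) = 0 ->
  forall i, c i = 0.
Proof.
pose b i := braidU (braid3_word (nth [::] Q3_basis i)).
have -> : \sum_i c i *: word_eval Q3letter (nth [::] Q3_basis i) =
    Qpi (\sum_i c i *: b i).
  rewrite [RHS]linear_sum; apply: eq_bigr => i _.
  by rewrite [RHS]linearZ; congr (_ *: _); apply: esym; apply: Qbraid_word.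
move=> /quot_pi0P /(ideal_gen_ker (f := rep) rep_Qrel) rep0 k.
have repS : \sum_i c i *: rep (b i) = 0.
  rewrite -[RHS]rep0 [RHS]linear_sum; apply: eq_bigr => i _.
  by apply: esym; apply: linearZ.
have bE i : (c i *: rep (b i)) k 0 = c i * (k == i)%:R.
  rewrite mxE; congr (_ * _).
  rewrite -[rep (b i)]/((rep : {lrmorphism _ -> _}) _) morph_braid_word.
  rewrite (eq_word_eval rep_morph_letter).
  apply: (column_is_sound laurent_mono1 laurent_monoM).
  by apply: (allP action_unit); rewrite mem_iota /= ltn_ord.
have := congr1 (fun M : 'M[laurent]_20 => M k 0) repS.
rewrite summxE [RHS]mxE (bigD1 k) //= bE eqxx mulr1 big1 ?addr0 // => i ik.
by rewrite bE eq_sym (negPf ik) mulr0.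
Qed.

Local Open Scope classical_set_scope.

(** * The theorem *)

Lemma Qincl_Q2letter b : Qincl (Q2letter (false, b)) = Q3letter (false, b).
Proof.
rewrite /Q2letter /Qletter Qincl_braid; congr Qbraid.
have E : braid_incl (@artin 2 (@ord0 0)) = @artin 3 (@ord0 1).
  by rewrite braid_incl_artin; congr artin; apply: val_inj.
by case: b; rewrite /braid_letter /= ?braid_inclV E.
Qed.

(** Restricted to words in s_1, since [Q2letter] also gives the letter coding s_2 the value s_1. *)
Lemma Qincl_word w : w \in Q2_basis ->
  Qincl (word_eval Q2letter w) = word_eval Q3letter w.
Proof.
rewrite !inE => /or3P[] /eqP ->; rewrite /word_eval ?big_seq1 ?big_nil.
- exact: rmorph1.
- exact: Qincl_Q2letter.
- exact: Qincl_Q2letter.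
Qed.

Lemma Qincl2_inj : injective (@Qincl 2).
Proof.
move=> u v /eqP; rewrite -subr_eq0 => /eqP uv0; apply/eqP; rewrite -subr_eq0.
have : Qincl (u - v) = 0 by rewrite -[RHS]uv0; apply: linearB.
have [c ->] := Q2_span (u - v) => sum0.
(* Padded with 17 zeros, coordinates along [Q2_basis] become coordinates along [Q3_basis], which
   starts with the same three words. *)
pose d (i : 'I_(3 + 17)) := if split i is inl j then c j else 0.
suff /Q3_free d0 : \sum_(i < 3 + 17)
    d i *: word_eval Q3letter (nth [::] Q3_basis i) = 0.
  rewrite big1 // => i _; have := d0 (lshift 17 i).
  by rewrite /d (unsplitK (inl i)) => ->; rewrite scale0r.
rewrite big_split_ord /= [X in _ + X]big1 ?addr0 => [|i _]; last first.
  by rewrite /d (unsplitK (inr i)) scale0r.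
rewrite -[RHS]sum0 [RHS]linear_sum; apply: eq_bigr => i _.
rewrite /d (unsplitK (inl i)) [nth _ Q3_basis _]nth_cat (ltn_ord i).
by rewrite -Qincl_word ?mem_nth //; apply: esym; apply: linearZ.
Qed.

Lemma Q3_free_of_rank : free_of_rank (Q 3) 20.
Proof.
exists (fun i => word_eval Q3letter (nth [::] Q3_basis i)) => v.
have [c ->] := Q3_span v; exists [ffun i => c i]; split.
  by apply: eq_bigr => i _; rewrite ffunE.
move=> d cd; apply/ffunP => i; rewrite ffunE; apply/eqP; rewrite -subr_eq0.
apply/eqP; move: i; apply: (@Q3_free (fun i => c i - d i)).
under eq_bigr do rewrite scalerBl.
by rewrite sumrB cd subrr.
Qed.

(** * Submodules as classical sets *)

Section LinearSets.
Variables (K : comNzRingType) (V : lmodType K).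

Definition linear_set (S : set V) : Prop :=
  S 0 /\ forall (c : K) u v, S u -> S v -> S (c *: u + v).

Lemma linear_set_lspan (S : set V) : linear_set (lspan S).
Proof.
split.
  by exists 0%N, (fun=> 0), (fun=> 0); split=> [[]//|]; rewrite big_ord0.
move=> c u v [m [a [x [Sx ->]]]] [n [b [y [Sy ->]]]].
exists (m + n)%N,
  (fun i => match split i with inl j => c * a j | inr j => b j end),
  (fun i => match split i with inl j => x j | inr j => y j end).
split=> [i|]; first by case: (split i).
rewrite big_split_ord scaler_sumr; congr (_ + _); apply: eq_bigr => i _.
  by rewrite (unsplitK (inl i)) scalerA.
by rewrite (unsplitK (inr i)).
Qed.

Lemma lspan_mem (S : set V) u : S u -> lspan S u.
Proof.
by move=> Su; exists 1%N, (fun=> 1), (fun=> u); rewrite big_ord1 scale1r.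
Qed.

Lemma linear_set_add (S T : set V) :
  linear_set S -> linear_set T -> linear_set (S :+: T).
Proof.
move=> [S0 SL] [T0 TL]; split.
  by exists 0 => //; exists 0 => //; rewrite addr0.
move=> c _ _ [u Su [v Tv <-]] [u' Su' [v' Tv' <-]].
exists (c *: u + u'); first exact: SL.
by exists (c *: v + v'); [apply: TL | rewrite scalerDr addrACA].
Qed.

Lemma addset_l (S T : set V) : linear_set T -> S `<=` S :+: T.
Proof.
by move=> [T0 _] u Su; exists u => //; exists 0 => //; rewrite addr0.
Qed.

Lemma addset_r (S T : set V) : linear_set S -> T `<=` S :+: T.
Proof.
by move=> [S0 _] u Tu; exists 0 => //; exists u => //; rewrite add0r.
Qed.

End LinearSets.

Lemma linear_set_range (K : comNzRingType) (U V : lmodType K)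
  (f : {linear U -> V}) : linear_set (range f).
Proof.
split; first by exists 0 => //; apply: linear0.
by move=> c _ _ [u _ <-] [v _ <-]; exists (c *: u + v) => //; apply: linearP.
Qed.

Lemma linear_set_full (S : set (Q 3)) : linear_set S ->
  {in Q3_basis, forall w, S (word_eval Q3letter w)} -> [set: Q 3] = S.
Proof.
move=> [S0 SL] Sw; apply/seteqP; split=> // v _; have [c ->] := Q3_span v.
elim/big_ind: _ => [//|x y Sx Sy|i _]; first by rewrite -[x]scale1r; apply: SL.
by rewrite -[_ *: _]addr0; apply: SL => //; apply/Sw/mem_nth.
Qed.

(** The rule for s_2 s_1^-1 s_2 read backwards, as an expression for s_2^-1 s_1 s_2^-1. The relator
    is not normalised, so s_2 s_1^-1 s_2 survives on the right. *)
Definition last_word_rule : rule :=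
  solve_for [:: g2'; g1; g2']
    (relator Q3_completion [::] [:: g2; g1'; g2] [::]).

Lemma last_word_rule_sound : word_eval Q3letter [:: g2'; g1; g2'] =
  ncpoly_eval laurent_mono Q3letter last_word_rule.2.
Proof.
apply: (@solve_for_sound _ _ laurent_mono1 laurent_monoM _ Q3letter
          [:: g2'; g1; g2']).
apply: (relator_sound laurent_mono1 laurent_monoM).
exact/(complete_sound laurent_mono1 laurent_monoM)/Q3_rules_sound.
Qed.

Definition spanning_words (w0 : seq letter) : seq (seq letter) :=
  w0 :: Q2_basis ++ sandwiches g2 ++ sandwiches g2'.

Lemma Q3_basis_spanning_words w w0 : w \in Q3_basis ->
  w = [:: g2'; g1; g2'] \/ w \in spanning_words w0.
Proof.
(* Membership is computed for one explicit first word; the tail of the list is the same for every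
   [w0]. *)
move=> /(allP (_ : all (mem (spanning_words [:: g2'; g1; g2'])) Q3_basis)).
rewrite /= !(in_cons _ (_ ++ _)) => /(_ isT) /orP[/eqP|]; first by left.
by move=> wP; right; apply/orP; right.
Qed.

(** The right-hand side is a submodule, so it is enough to find the 20 basis words in it; all but
    s_2^-1 s_1 s_2^-1 lie in Q_2 or in a sandwich span. *)
Lemma Q3_decomposition w0 :
  w0 \in [:: [:: g2; g1'; g2]; [:: g2'; g1; g2']] ->
  let Q2 := range (@Qincl 2) in
  [set: Q 3] = Q2 :+: prodspan Q2 (Q3letter g2) Q2
    :+: prodspan Q2 (Q3letter g2') Q2 :+: lspan [set word_eval Q3letter w0].
Proof.
move=> w0P Q2; set S := (X in _ = X).
have Q2L : linear_set Q2 by apply: linear_set_range.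
have SL : linear_set S.
  by do 3!(apply: linear_set_add; last exact: linear_set_lspan).
have Q2w w : w \in Q2_basis -> Q2 (word_eval Q3letter w).
  by move=> wP; exists (word_eval Q2letter w); rewrite ?Qincl_word.
have sandwichP l w : w \in sandwiches l ->
    prodspan Q2 (Q3letter l) Q2 (word_eval Q3letter w).
  case/allpairsP=> [[u v] [/= uP vP ->]]; apply: lspan_mem.
  exists (word_eval Q3letter u); first exact: Q2w.
  exists (word_eval Q3letter v); first exact: Q2w.
  by rewrite word_eval_cat /word_eval big_cons mulrA.
have Sword w : w \in spanning_words w0 -> S (word_eval Q3letter w).
  rewrite in_cons mem_cat [X in _ || (_ || X)]mem_cat.
  case/or4P=> [/eqP ->|wP|wP|wP].
  - apply: addset_r; last exact: lspan_mem.
    by do 2!(apply: linear_set_add; last exact: linear_set_lspan).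
  - do 3!(apply: addset_l; first exact: linear_set_lspan); exact: Q2w.
  - do 2!(apply: addset_l; first exact: linear_set_lspan).
    exact/addset_r/sandwichP.
  apply: addset_l; first exact: linear_set_lspan.
  apply: addset_r; last exact: sandwichP.
  exact/linear_set_add/linear_set_lspan.
apply: linear_set_full => // w /(Q3_basis_spanning_words w0)[->|]; last first.
  exact: Sword.
have [S0 SLin] := SL.
move: w0P; rewrite !inE => /orP[] /eqP w0E; last first.
  by apply: Sword; rewrite -w0E mem_head.
(* Here [w0] is s_2 s_1^-1 s_2, and the remaining basis word is expanded into spanning words. *)
rewrite last_word_rule_sound /ncpoly_eval; set p := last_word_rule.2.
have : all (fun t => t.1 \in spanning_words w0) p by rewrite w0E; vm_compute.
elim: p => [|t p IHp] /=; first by rewrite big_nil.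
move=> /andP[/Sword St /IHp Sp]; rewrite big_cons; exact: SLin.
Qed.

Theorem theorem3p1 :
  let sigma1 : braid 3 := @artin 3 (@ord0 1) in
  let sigma2 : braid 3 := @artin 3 (@ord_max 1) in
  let s1 : Q 3 := Qbraid sigma1 in
  let s1V : Q 3 := Qbraid sigma1^-1%g in
  let s2 : Q 3 := Qbraid sigma2 in
  let s2V : Q 3 := Qbraid sigma2^-1%g in
  let Q2 : set (Q 3) := range (@Qincl 2) in
  [/\ injective (@Qincl 2),
      free_of_rank (Q 3) 20,
      [set: Q 3] = Q2 :+: prodspan Q2 s2 Q2 :+: prodspan Q2 s2V Q2
                     :+: lspan [set s2 * s1V * s2]
    & [set: Q 3] = Q2 :+: prodspan Q2 s2 Q2 :+: prodspan Q2 s2V Q2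
                     :+: lspan [set s2V * s1 * s2V]].
Proof.
move=> sigma1 sigma2 s1 s1V s2 s2V Q2.
have word3 k l m : word_eval Q3letter [:: k; l; m] =
    Q3letter k * Q3letter l * Q3letter m.
  by rewrite /word_eval !big_cons big_nil mulr1 mulrA.
split.
- exact: Qincl2_inj.
- exact: Q3_free_of_rank.
- by have := @Q3_decomposition [:: g2; g1'; g2] isT; rewrite word3.
by have := @Q3_decomposition [:: g2'; g1; g2'] isT; rewrite word3.
Qed.
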